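(* Let $\mathcal{A}$ be a central and essential hyperplane arrangement in $\mathbb{R}^d$ and let $H$ be an affine hyperplane, generic with respect to $\mathcal{A}$. Then the collection of cycles $\rho_R$ corresponding to regions $R$ of $\mathcal{A}$ such that $R\cap H$ is nonempty and bounded forms a basis of $\widetilde H_{d-2}(\overline{L}_{\mathcal{A}};\mathbb{Z})$.
   Context: $\mathcal{A}$ is a finite set of linear hyperplanes with $\bigcap_{K\in\mathcal{A}}K=\{0\}$. $L_{\mathcal{A}}$ is the intersection lattice (all intersections of subfamilies of $\mathcal{A}$, ordered by reverse inclusion; $\hat0=\mathbb{R}^d$, $\hat1=\{0\}$), and $\overline{L}_{\mathcal{A}}=L_{\mathcal{A}}\setminus\{\hat0,\hat1\}$; homology of a poset means homology of its order complex. $H$ is generic if $\dim(H\cap X)=\dim X-1$ for all $X\in L_{\mathcal{A}}$. Regions are the connected components of $\mathbb{R}^d\setminus\bigcup\mathcal{A}$ (open pointed polyhedral cones). For a region $R$, let $z(P_R)$ be the set of linear spans of the nonempty faces of the closed cone $\mathrm{cl}(R)$ (these are elements of $L_{\mathcal{A}}$), ordered as a subposet of $L_{\mathcal{A}}$; it is a copy of the dual of the face lattice of $\mathrm{cl}(R)$, and the order complex of its proper part $z(P_R)\setminus\{\hat0,\hat1\}$ is homeomorphic to $S^{d-2}$. $\rho_R\in\widetilde H_{d-2}(\overline{L}_{\mathcal{A}})$ is the fundamental cycle (determined up to sign) of this sphere. *)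

(* Defs.v *)
From HB Require Import structures.
From mathcomp Require Import all_boot all_order all_algebra finmap.
From mathcomp Require Import ring_quotient.
From mathcomp Require Import all_classical all_reals all_analysis.

Set Implicit Arguments.
Unset Strict Implicit.
Unset Printing Implicit Defensive.

Import Order.TTheory GRing.Theory Num.Theory.
Import numFieldNormedType.Exports.

Local Open Scope classical_set_scope.
Local Open Scope ring_scope.

(** Reduced simplicial homology, with integer coefficients, of the order
    complex of the subposet [P] of a finite strict order [(T, lt)].

    Degrees are shifted by one: index [k] refers to chains with [k] elements,
    i.e. to simplices of dimension [k - 1]; index 0 is the augmentation term
    spanned by the empty chain.  A simplex is oriented by listing its vertices
    increasingly. *)
Section OrderComplexHomology.
Variables (T : finType) (lt : rel T).
Implicit Types (P : {set T}) (k : nat).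

Definition chain_group P k : {pred {ffun k.-tuple T -> int}} :=
  [pred c : {ffun k.-tuple T -> int} | [forall s : k.-tuple T,
     (c s != 0) ==> sorted lt s && all (fun x => x \in P) s]].

Definition omit (i : nat) (s : seq T) : seq T := take i s ++ drop i.+1 s.

(* For [k = 0] the inner sum is empty, so the boundary is zero. *)
Definition boundary k (c : {ffun k.-tuple T -> int}) :
    {ffun k.-1.-tuple T -> int} :=
  [ffun t : k.-1.-tuple T =>
     \sum_(s : k.-tuple T) \sum_(i < k | omit i s == t) (-1) ^+ i * c s].

Definition cycles P k : {pred {ffun k.-tuple T -> int}} :=
  [pred c : {ffun k.-tuple T -> int} |
     (c \in @chain_group P k) && (boundary c == 0)].

Lemma boundaryB k : {morph @boundary k : c c' / c - c'}.
Proof.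
move=> c c'; apply/ffunP => t; rewrite !ffunE -sumrB.
by apply: eq_bigr => s _; rewrite -sumrB; apply: eq_bigr => i _;
  rewrite !ffunE mulrBr.
Qed.

Lemma boundary0 k : boundary (0 : {ffun k.-tuple T -> int}) = 0.
Proof. by rewrite -[X in boundary X](subrr 0) boundaryB subrr. Qed.

Fact chain_group_zmod_closed P k : zmod_closed (@chain_group P k).
Proof.
split=> [|c c' /forallP cP /forallP c'P].
  by apply/forallP => s; rewrite ffunE eqxx.
apply/forallP => s; apply/implyP; rewrite !ffunE => nz.
have := cP s; have := c'P s.
case: (c s =P 0) nz => [->|_ _ _ //]; rewrite sub0r oppr_eq0 => nz.
by rewrite nz.
Qed.

HB.instance Definition _ P k := GRing.isZmodClosed.Build _
  (@chain_group P k) (@chain_group_zmod_closed P k).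

Fact cycles_zmod_closed P k : zmod_closed (@cycles P k).
Proof.
split=> [|c c' /andP[cP /eqP c0] /andP[c'P /eqP c'0]]; apply/andP.
  by split; [exact: rpred0 | rewrite boundary0].
by split; [exact: rpredB | rewrite boundaryB c0 c'0 subrr].
Qed.

HB.instance Definition _ P k := GRing.isZmodClosed.Build _
  (@cycles P k) (@cycles_zmod_closed P k).

Record cycle P k := Cycle {
  cycle_val :> {ffun k.-tuple T -> int};
  _ : cycle_val \in @cycles P k }.

HB.instance Definition _ P k := [isSub for @cycle_val P k].
HB.instance Definition _ P k := [Choice of cycle P k by <:].
HB.instance Definition _ P k := [SubChoice_isSubZmodule of cycle P k by <:].

Definition boundaries P k : {pred cycle P k} :=
  [pred z : cycle P k | `[< exists2 b, b \in @chain_group P k.+1 & val z = boundary b >]].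

Fact boundaries_zmod_closed P k : zmod_closed (@boundaries P k).
Proof.
split=> [|z z' /asboolP[b bP zb] /asboolP[b' b'P zb']]; apply/asboolP.
  by exists 0; rewrite ?rpred0 // boundary0.
by exists (b - b'); rewrite ?rpredB // boundaryB raddfB -zb -zb'.
Qed.

HB.instance Definition _ P k := GRing.isZmodClosed.Build _
  (@boundaries P k) (@boundaries_zmod_closed P k).

(* The reduced homology group in degree [k - 1]. *)
Definition homology P k := Quotient.quot (@boundaries P k : zmodClosed _).

HB.instance Definition _ P k := GRing.Zmodule.on (homology P k).

Definition hclass P k (z : cycle P k) : homology P k :=
  \pi_(homology P k)%qT z.

Lemma hclassP P k (z z' : cycle P k) :
  reflect (hclass z = hclass z') (z - z' \in @boundaries P k).
Proof. by rewrite Quotient.idealrBE; apply: eqP. Qed.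

End OrderComplexHomology.

(* [b], restricted to the index set [D], is a basis of the abelian group [M]. *)
Definition Zbasis (M : zmodType) (I : choiceType) (D : set I) (b : I -> M) :=
  forall h : M, exists! a : {fsfun I -> int with 0},
    (forall i, i \in finsupp a -> D i) /\
    h = \sum_(i <- finsupp a) b i *~ a i.

Section Arrangements.
Variables (R : realType) (d : nat).
Local Notation V := 'rV[R]_d.
Implicit Types (A : {fset {vspace V}}) (H C F S : set V) (X W : {vspace V}).

Definition hyperplane_arrangement A :=
  forall K, K \in A -> (\dim K).+1 = d.

Definition essential A := (\bigcap_(K <- A) K)%VS = 0%VS.

(* The empty subfamily contributes the whole space. *)
Definition intersections A : {fset {vspace V}} :=
  [fset (\bigcap_(K <- (B : {fset {vspace V}})) K)%VS | B in fpowerset A]%fset.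

(* The strict order of the intersection lattice: reverse inclusion. *)
Definition latt_lt A : rel (intersections A) :=
  fun X Y : intersections A => (val X != val Y) && (val Y <= val X)%VS.

Definition proper_part A (P : {set intersections A}) : {set intersections A} :=
  [set X : intersections A in P | (val X != fullv) && (val X != 0%VS)]%SET.

Definition Lbar A : {set intersections A} :=
  proper_part [set: intersections A]%SET.

Definition translate (p : V) W : set V := [set x | x - p \in W].

Definition affine_hyperplane H :=
  exists p W, (\dim W).+1 = d /\ H = translate p W.

(* [S] is an affine subspace of dimension [n]; the empty set has dimension
   -1. *)
Definition affine_dim S (n : int) :=
  (S = set0 /\ n = -1) \/
  (exists p W, S = translate p W /\ n = (\dim W)%:Z).

(* For [X = 0] this says that [H] misses the origin. *)
Definition generic A H :=
  forall X, X \in intersections A ->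
    affine_dim (H `&` [set x | x \in X]) ((\dim X)%:Z - 1).

Definition arrangement_complement A : set V :=
  [set x | forall K, K \in A -> x \notin K].

Definition region A C :=
  exists2 x, arrangement_complement A x &
    C = connected_component (arrangement_complement A) x.

Definition face C F :=
  exists (f : {scalar V}) (m : R),
    (forall x, C x -> f x <= m) /\ F = [set x | C x /\ f x = m].

Definition linear_span F X :=
  (forall x, F x -> x \in X) /\
  (forall W, (forall x, F x -> x \in W) -> (X <= W)%VS).

Definition zP A C : {set intersections A} :=
  [set X : intersections A | `[< exists F, [/\ face (closure C) F, F !=set0 &
                             linear_span F (val X)] >]]%SET.

(* A fundamental cycle of the sphere given by the proper part of [zP A C]: a
   generator of the infinite cyclic top homology of that sphere, read as a
   homology class of the proper part of the intersection lattice.  Dimension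
   [d - 2] is index [d.-1] for [homology]. *)
Definition fundamental_class A C (r : homology (@latt_lt A) (Lbar A) d.-1) :=
  exists (z : cycle (@latt_lt A) (proper_part (zP A C)) d.-1)
         (w : cycle (@latt_lt A) (Lbar A) d.-1),
    [/\ forall h, exists! n : int, h = hclass z *~ n,
        val w = val z & r = hclass w].

End Arrangements.

(* Main.v *)
Require Import Defs.
From HB Require Import structures.
From mathcomp Require Import all_boot all_order all_algebra finmap.
From mathcomp Require Import ring lra.
From mathcomp Require Import all_classical all_reals all_analysis.
Import Order.TTheory GRing.Theory Num.Theory.
Import numFieldNormedType.Exports.
Set Implicit Arguments.
Unset Strict Implicit.
Unset Printing Implicit Defensive.
Local Open Scope classical_set_scope.
Local Open Scope ring_scope.

(** Let [H = {phi = 1}]. In top degree there are no boundaries, so the homology of [Lbar A] is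
    the group of integer functions on complete flags [X_1 > ... > X_d = 0] of the lattice whose
    sum over all fillings of any missing entry vanishes (cycles). To an integer function [a] on
    the chambers one associates the function on flags given by its iterated jumps across [X_1],
    [X_2], ...; coherent signs come from crossing every hyperplane of [X] along one vector [n X]
    attached to [X] by a generic flag of functionals. A deletion-restriction induction shows that
    this is a bijection from the functions supported on the chambers where [phi > 0] onto the
    cycles. A chamber meets [H] in a nonempty bounded set exactly when [phi > 0] on it. The
    iterated jump of the indicator of such a chamber [C] is supported on flags of spans of faces
    of [C], hence is a multiple of the fundamental cycle of [C], and the bijectivity over the
    integers makes the factor invertible. *)

(** * Functionals and chambers *)

(** Jumps forget a great deal: constants, for instance, have none. Positivity restores injectivity.
    If the jump across [K] vanishes, the function descends to the deletion of [K]; once every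
    hyperplane of a nonzero space is deleted, the space is a single chamber containing opposite
    vectors, so it cannot be positive. The obstacle is that a deletion need not be essential, so the
    induction ranges over sublists of forms on all flats. When the hyperplanes share a nonzero
    subspace there are no complete flags, but no positive chambers either, since [phi] does not
    vanish on that subspace: both sides of the bijection are zero. The vectors [n X] are tied
    together across consecutive ranks: for hyperplanes [K], [K'] of [X], [n K] and [n K'] differ by
    a multiple of [n X]. This puts all crossings through a flat of codimension two on one line,
    along which double jumps telescope. The homology of the sphere of a chamber is never computed:
    that its fundamental cycle is a generator is part of the definition, and the integral bijection
    on the whole lattice does the rest. *)

Section Forms.
Variables (R : realFieldType) (V : vectType R).
Local Notation form := 'Hom(V, R^o).
Implicit Types (l : form) (A : seq form) (X Y K Z : {vspace V}) (x y u v : V).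

Definition ev l x : R := l x.

Lemma evD l x y : ev l (x + y) = ev l x + ev l y.
Proof. by rewrite /ev linearD. Qed.

Lemma evN l x : ev l (- x) = - ev l x.
Proof. by rewrite /ev linearN. Qed.

Lemma evB l x y : ev l (x - y) = ev l x - ev l y.
Proof. by rewrite /ev linearB. Qed.

Lemma evZ l a x : ev l (a *: x) = a * ev l x.
Proof. by rewrite /ev linearZ. Qed.

Lemma ev0 l : ev l 0 = 0.
Proof. by rewrite /ev linear0. Qed.

Lemma mem_ker l x : (x \in lker l) = (ev l x == 0).
Proof. exact: memv_ker. Qed.

Lemma vanish_ev X l x : (X <= lker l)%VS -> x \in X -> ev l x = 0.
Proof. by move=> /subvP s /s; rewrite mem_ker => /eqP. Qed.

Lemma nvanishP X l : reflect (exists2 x, x \in X & ev l x != 0) (~~ (X <= lker l)%VS).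
Proof.
apply: (iffP idP) => [/subvPn [x xX]|[x xX nz]].
  by rewrite mem_ker; exists x.
by apply/subvPn; exists x; rewrite ?mem_ker.
Qed.

Lemma mul_pos_trans (a b c : R) : 0 < a * b -> 0 < a * c -> 0 < b * c.
Proof.
move=> ab ac.
have a2 : 0 < a ^+ 2.
  by rewrite exprn_even_gt0 //=; apply: contraTneq ab => ->; rewrite mul0r ltxx.
have e : a ^+ 2 * (b * c) = (a * b) * (a * c) by ring.
by rewrite -(pmulr_rgt0 _ a2) e mulr_gt0.
Qed.

(** A positive product says that both values are nonzero with equal signs, so [same] is a partial
    equivalence relation with domain [gen], and its classes are the chambers. *)
Definition same A x y := all (fun l => 0 < ev l x * ev l y) A.
Definition gen A x := all (fun l => ev l x != 0) A.
(* The list [restr A K] describes the deletion of [K] in the ambient space [X] as well as the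
   restriction to [K] in the ambient space [K]. *)
Definition restr A K := [seq l <- A | ~~ (K <= lker l)%VS].
(** Different forms may cut out the same hyperplane of [X], in particular after a restriction;
    [undup] makes it count once in the sums that define cycles. *)
Definition hyps A X := undup [seq (X :&: lker l)%VS | l <- A].
Definition nonv A X := all (fun l => ~~ (X <= lker l)%VS) A.

(* [x] has the signs of [y] perturbed infinitesimally in the direction [v]. *)
Definition beside A y v x :=
  all (fun l => if ev l y == 0 then 0 < ev l v * ev l x else 0 < ev l y * ev l x) A.

Lemma same_sym A x y : same A x y = same A y x.
Proof. by apply: eq_all => l /=; rewrite mulrC. Qed.

Lemma same_trans A y x z : same A x y -> same A y z -> same A x z.
Proof.
move=> /allP xy /allP yz; apply/allP => l lA.
by apply: mul_pos_trans (yz l lA); rewrite mulrC; apply: xy.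
Qed.

Lemma same_refl A x : gen A x -> same A x x.
Proof.
by move=> /allP g; apply/allP => l /g nz; rewrite -expr2 exprn_even_gt0.
Qed.

Lemma same_gen A x y : same A x y -> gen A x.
Proof.
move=> /allP xy; apply/allP => l /xy; apply: contraTneq => /= ->.
by rewrite mul0r ltxx.
Qed.

Lemma same_genr A x y : same A x y -> gen A y.
Proof. by rewrite same_sym; apply: same_gen. Qed.

Lemma same_sub A A' x y : {subset A' <= A} -> same A x y -> same A' x y.
Proof. by move=> s /allP xy; apply/allP => l /s /xy. Qed.

Lemma gen_sub A A' x : {subset A' <= A} -> gen A x -> gen A' x.
Proof. by move=> s /allP xy; apply/allP => l /s /xy. Qed.

Lemma restr_sub A K : {subset restr A K <= A}.
Proof. by move=> l; rewrite mem_filter => /andP[]. Qed.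

Lemma nonv_restr A K : nonv (restr A K) K.
Proof. exact: filter_all. Qed.

Lemma beside_same A y v x x' : beside A y v x -> beside A y v x' -> same A x x'.
Proof.
move=> /allP n1 /allP n2; apply/allP => l lA; move: (n1 l lA) (n2 l lA).
by case: ifP => _; apply: mul_pos_trans.
Qed.

Lemma beside_gen A y v x : beside A y v x -> gen A x.
Proof. by move=> n; apply: same_gen (beside_same n n). Qed.

Lemma hypsP A X K : reflect (exists2 l, l \in A & K = (X :&: lker l)%VS) (K \in hyps A X).
Proof. by rewrite mem_undup; apply: mapP. Qed.

Lemma hyps_uniq A X : uniq (hyps A X).
Proof. exact: undup_uniq. Qed.

Lemma hyps_sub A X K : K \in hyps A X -> (K <= X)%VS.
Proof. by move=> /hypsP[l _ ->]; apply: capvSl. Qed.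

Lemma dim_cap_ker X l : ~~ (X <= lker l)%VS -> (\dim (X :&: lker l)).+1 = \dim X.
Proof.
move=> nX; rewrite -(limg_ker_dim l X) -addn1; congr addn.
apply/esym/eqP; rewrite eqn_leq; apply/andP; split.
  by have := dimvS (subvf (l @: X)%VS); rewrite dimvf.
rewrite lt0n dimv_eq0; apply: contra nX => /eqP e0.
by apply/subvP => x xX; rewrite memv_ker -memv0 -e0 memv_img.
Qed.

Lemma dim_hyps A X K : nonv A X -> K \in hyps A X -> (\dim K).+1 = \dim X.
Proof. by move=> /allP nA /hypsP[l lA ->]; apply/dim_cap_ker/nA. Qed.

Lemma hyps_ker A X K l : nonv A X -> K \in hyps A X -> l \in A -> (K <= lker l)%VS ->
  K = (X :&: lker l)%VS.
Proof.
move=> nA hK lA Kl; have := dim_hyps nA hK.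
have := dim_cap_ker (allP nA l lA) => <- /eqP; rewrite eqSS => /eqP dK.
by apply/eqP; rewrite eqEdim subv_cap Kl (hyps_sub hK) dK leqnn.
Qed.

Lemma nonv_nz A X : nonv A X -> A != [::] -> X != 0%VS.
Proof.
case: A => // l A /andP[+ _] _; apply: contra => /eqP ->; exact: sub0v.
Qed.

Lemma restr_restr A K Z : (Z <= K)%VS -> restr (restr A K) Z = restr A Z.
Proof.
move=> ZK; rewrite /restr -filter_predI; apply: eq_filter => l /=.
by apply: andb_idr; apply: contra; apply: subv_trans.
Qed.

(* The terms with [ev l y = 0] contribute [0], since [r / 0 = 0]. *)
Definition eps A y v : R := (1 + \sum_(l <- A) `|ev l v| / `|ev l y|)^-1.
Definition push A y v := y + eps A y v *: v.

Lemma eps_gt0 A y v : 0 < eps A y v.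
Proof.
rewrite invr_gt0 ltr_wpDr //; apply: sumr_ge0 => l _.
by rewrite divr_ge0.
Qed.

(** The summand of [l] in [eps] makes the displacement [eps A y v * |ev l v|] smaller than
    [|ev l y|]. *)
Lemma eps_sign A y v l : l \in A -> ev l y != 0 ->
  0 < ev l y * ev l (push A y v).
Proof.
move=> lA nz; rewrite /push evD evZ mulrDr.
set S := \sum_(l <- A) `|ev l v| / `|ev l y|.
have S0 : `|ev l v| / `|ev l y| <= S.
  rewrite /S (big_rem l) //= lerDl; apply: sumr_ge0 => l' _; exact: divr_ge0.
have ny : 0 < `|ev l y| by rewrite normr_gt0.
have e0 := eps_gt0 A y v.
have e1 : eps A y v * (1 + S) = 1.
  by rewrite mulVf // gt_eqF // -invr_gt0.
have lt1 : eps A y v * `|ev l v| < `|ev l y|.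
  rewrite -[X in _ < X]mul1r -(ltr_pdivrMr _ _ ny) -mulrA -e1 ltr_pM2l //.
  by rewrite ltr_pwDl.
have -> : ev l y * ev l y = `|ev l y| * `|ev l y|.
  by rewrite -normrM ger0_norm // -expr2 sqr_ge0.
rewrite -[X in _ + X]opprK subr_gt0.
apply: (@le_lt_trans _ _ (`|ev l y| * (eps A y v * `|ev l v|))).
  rewrite -[X in _ <= _ * (X * _)]gtr0_norm // -!normrM.
  by rewrite -normrN ler_norm.
by rewrite ltr_pM2l.
Qed.

Lemma push_beside_dir A y u v :
  (forall l, l \in A -> ev l y = 0 -> 0 < ev l u * ev l v) -> beside A y u (push A y v).
Proof.
move=> h; apply/allP => l lA; case: ifP => [/eqP y0|/negbT]; last exact: eps_sign.
by rewrite /push evD evZ y0 add0r mulrCA mulr_gt0 ?eps_gt0 ?h.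
Qed.

Lemma push_beside A y v : (forall l, l \in A -> ev l y = 0 -> ev l v != 0) ->
  beside A y v (push A y v).
Proof.
by move=> h; apply: push_beside_dir => l lA y0; rewrite -expr2 exprn_even_gt0 //= h.
Qed.

Lemma push_in A X y v : y \in X -> v \in X -> push A y v \in X.
Proof. by move=> yX vX; rewrite memvD // memvZ. Qed.

End Forms.

(** * Iterated jumps of chamber functions *)

Section Telescope.
Variables (R : realFieldType) (I : eqType) (m : I -> R) (G : R -> int) (J : I -> int).

(** [G] behaves as a step function that changes only at the times [m k], at which it is never
    evaluated. The bound [t0 <= t'] lets the induction drop the first crossing: all later samples
    lie beyond a midpoint [t] that follows it. *)
Lemma sum_jumps_sorted (ks : seq I) t0 t1 : ks != [::] ->
  sorted (fun i j => m i < m j) ks -> {in ks, forall k, t0 < m k < t1} ->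
  (forall k t t', k \in ks -> t0 <= t' -> t' < m k -> m k < t ->
     {in ks, forall k', k' != k -> (t < m k') || (m k' < t')} -> J k = G t - G t') ->
  \sum_(k <- ks) J k = G t1 - G t0.
Proof.
elim: ks t0 => // k1 [|k2 ks] IH t0 _ srt bd jmp.
  have /andP[lt0 lt1] := bd k1 (mem_head _ _).
  rewrite big_seq1; apply: jmp; rewrite ?mem_head //.
  by move=> k; rewrite inE => ->.
have tr : transitive (fun i j => m i < m j) by move=> y x z; apply: lt_trans.
pose t := (m k1 + m k2) / 2.
have m12 : m k1 < m k2 by case/andP: srt.
have bd2 : {in k2 :: ks, forall k, m k2 <= m k}.
  move=> k; rewrite inE => /orP[/eqP -> //|kks]; apply: ltW.
  have : path (fun i j => m i < m j) k2 ks by case/andP: srt.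
  by rewrite (path_sortedE tr) => /andP[/allP /(_ _ kks)].
have /andP[lt0 lt1] := bd k1 (mem_head _ _).
have lt1t : m k1 < t by rewrite /t; lra.
have ltt2 : t < m k2 by rewrite /t; lra.
rewrite big_cons (IH t) //.
- rewrite (jmp k1 t t0) ?mem_head //; first by ring.
  move=> k; rewrite inE => /orP[/eqP ->|kks _]; first by rewrite eqxx.
  by rewrite (lt_le_trans ltt2) ?bd2.
- by case/andP: srt.
- move=> k kks; rewrite (lt_le_trans ltt2) ?bd2 //=.
  by have := bd k; rewrite inE kks orbT => /(_ isT) /andP[].
- move=> k u u' kks tu' u'm mu out; apply: jmp => //.
  + by rewrite inE kks orbT.
  + by apply: le_trans tu'; apply: ltW; apply: lt_trans lt1t.
  + move=> k'; rewrite inE => /orP[/eqP -> _|]; last exact: out.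
    by rewrite (lt_le_trans lt1t tu') orbT.
Qed.

Lemma sum_jumps (ks : seq I) t0 t1 : ks != [::] -> uniq ks -> {in ks &, injective m} ->
  {in ks, forall k, t0 < m k < t1} ->
  (forall k t t', k \in ks -> t' < m k -> m k < t ->
     {in ks, forall k', k' != k -> (t < m k') || (m k' < t')} -> J k = G t - G t') ->
  \sum_(k <- ks) J k = G t1 - G t0.
Proof.
move=> ks0 uks mi bd jmp; pose leT i j := m i <= m j.
have pks : perm_eq (sort leT ks) ks by rewrite perm_sort.
rewrite -(perm_big _ pks) /=; apply: sum_jumps_sorted.
- by rewrite -size_eq0 (perm_size pks) size_eq0.
- have tot : total leT by move=> i j; apply: le_total.
  have srt : sorted <=%R (map m (sort leT ks)) by rewrite sorted_map sort_sorted.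
  have : sorted <%R (map m (sort leT ks)); last by rewrite sorted_map.
  rewrite lt_sorted_uniq_le srt andbT map_inj_in_uniq ?sort_uniq //.
  by move=> i j; rewrite !mem_sort; apply: mi.
- by move=> k; rewrite mem_sort; apply: bd.
- move=> k t t'; rewrite mem_sort => kks _ h1 h2 h3; apply: jmp => //.
  by move=> k' k'ks; apply: h3; rewrite mem_sort.
Qed.

End Telescope.

(** * Chamber functions, flags and cycles on a flat *)

Section Framed.
Variables (R : realFieldType) (V : vectType R).
Local Notation form := 'Hom(V, R^o).
Implicit Types (l : form) (A : seq form) (X Y K Z : {vspace V}) (x y u v : V).
Implicit Types (a b : V -> int) (s : seq {vspace V}) (c : seq {vspace V} -> int).
Variables (Fl : pred {vspace V}) (A0 : seq form) (n : {vspace V} -> V) (phi : form).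
Hypothesis Fl_cap : forall Y l, Fl Y -> l \in A0 -> Fl (Y :&: lker l)%VS.
Hypothesis n_in : forall Y, Fl Y -> n Y \in Y.
Hypothesis n_gen : forall Y l, Fl Y -> l \in A0 -> ~~ (Y <= lker l)%VS -> ev l (n Y) != 0.
Hypothesis n_coh : forall Y K K', Fl Y -> K \in hyps (restr A0 Y) Y ->
  K' \in hyps (restr A0 Y) Y -> n K - n K' \in <[n Y]>%VS.
Hypothesis phi_gen : forall Y, Fl Y -> Y != 0%VS -> ~~ (Y <= lker phi)%VS.

(** Deletion shrinks the list of forms while the vectors [n] remain those of the full list [A0];
    hence [A] is only a sublist. *)
Definition framed A X := [/\ Fl X, {subset A <= A0} & nonv A X].

Lemma framed_restr A X K : framed A X -> K \in hyps A X -> framed (restr A K) K.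
Proof.
move=> [FX sA nA] /hypsP[l lA ->]; split; last exact: nonv_restr.
  by apply: Fl_cap => //; apply: sA.
by move=> l' /restr_sub /sA.
Qed.

Lemma framed_sub A A' X : framed A X -> {subset A' <= A} -> framed A' X.
Proof.
move=> [FX sA /allP nA] s; split=> //; first by move=> l /s /sA.
by apply/allP => l /s /nA.
Qed.

Lemma framed_n A X l : framed A X -> l \in A -> ev l (n X) != 0.
Proof. by move=> [FX sA /allP nA] lA; exact: n_gen FX (sA _ lA) (nA _ lA). Qed.

Lemma framed_nN A X l : framed A X -> l \in A -> ev l (- n X) != 0.
Proof. by move=> o lA; rewrite evN oppr_eq0 (framed_n o). Qed.

Lemma framed_beside A X y : framed A X -> beside A y (n X) (push A y (n X)).
Proof. by move=> o; apply: push_beside => l lA _; apply: framed_n o lA. Qed.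

Lemma framed_besideN A X y : framed A X -> beside A y (- n X) (push A y (- n X)).
Proof. by move=> o; apply: push_beside => l lA _; apply: framed_nN o lA. Qed.

Lemma framed_push A X y : framed A X -> y \in X -> push A y (n X) \in X.
Proof. by move=> [FX _ _] yX; apply: push_in => //; apply: n_in. Qed.

Lemma framed_pushN A X y : framed A X -> y \in X -> push A y (- n X) \in X.
Proof. by move=> [FX _ _] yX; apply: push_in => //; rewrite memvN n_in. Qed.

Definition jump A X a y := a (push A y (n X)) - a (push A y (- n X)).

Definition inv A X a := forall x y, x \in X -> y \in X -> same A x y -> a x = a y.

(* The clause [y != 0] makes the unique chamber of the zero space positive. *)
Definition positive A X x :=
  forall y, y \in X -> y != 0 -> same A x y -> 0 < ev phi y.

Definition chamberfun A X a :=
  inv A X a /\ forall x, x \in X -> gen A x -> a x != 0 -> positive A X x.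

(** On the zero space no form survives and [0] is a point of the only chamber, so the iteration ends
    with a value. Sequences that are not complete flags get [0]. *)
Fixpoint flag_jump A X a s : int :=
  match s with
  | [::] => if X == 0%VS then a 0 else 0
  | K :: s' => if K \in hyps A X then flag_jump (restr A K) K (jump A X a) s' else 0
  end.

Fixpoint flag A X s : bool :=
  match s with
  | [::] => X == 0%VS
  | K :: s' => (K \in hyps A X) && flag (restr A K) K s'
  end.

(* Flags end with the zero space, which is never varied: no condition on the last entry. *)
Inductive cyc A X c : Prop := Cyc of
  (forall s, c s != 0 -> flag A X s) &
  (forall Z s, \sum_(K <- hyps A X) c (K :: Z :: s) = 0) &
  (forall K, K \in hyps A X -> cyc (restr A K) K (fun s => c (K :: s))).

Lemma jumpE A X a y x x' : framed A X -> inv A X a -> y \in X -> x \in X -> x' \in X ->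
  beside A y (n X) x -> beside A y (- n X) x' -> jump A X a y = a x - a x'.
Proof.
move=> o ia yX xX x'X b1 b2; rewrite /jump; congr (_ - _).
  by apply: ia; rewrite ?framed_push //; apply: beside_same b1; apply: framed_beside.
by apply: ia; rewrite ?framed_pushN //; apply: beside_same b2; apply: framed_besideN.
Qed.

Lemma inv_jump A X K a : framed A X -> K \in hyps A X -> inv A X a ->
  inv (restr A K) K (jump A X a).
Proof.
move=> o hK ia y y' yK y'K /allP syy.
have /subvP KX := hyps_sub hK.
have tr v x : beside A y' v x -> beside A y v x.
  move=> /allP b; apply/allP => l lA; have := b l lA.
  case Kl: (K <= lker l)%VS.
    by rewrite (vanish_ev Kl yK) (vanish_ev Kl y'K) eqxx.
  have /syy : l \in restr A K by rewrite mem_filter Kl.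
  case: eqP => [->|_]; first by rewrite mulr0 ltxx.
  case: eqP => [->|_]; first by rewrite mul0r ltxx.
  by rewrite mulrC; apply: mul_pos_trans.
rewrite (jumpE o ia (KX _ yK) (framed_push o (KX _ y'K)) (framed_pushN o (KX _ y'K))) //.
- by apply/tr/framed_beside.
- by apply/tr/framed_besideN.
Qed.

Lemma nonv0 A X : nonv A X -> X = 0%VS -> A = [::].
Proof.
move=> nA X0; case: (altP (A =P [::])) => // /(nonv_nz nA).
by rewrite X0 eqxx.
Qed.

Lemma jump_ext A X a a' : framed A X -> (forall x, x \in X -> gen A x -> a x = a' x) ->
  forall y, y \in X -> jump A X a y = jump A X a' y.
Proof.
move=> o e y yX; rewrite /jump !e ?framed_push ?framed_pushN //.
  by apply: beside_gen (framed_besideN y o).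
by apply: beside_gen (framed_beside y o).
Qed.

Lemma flag_jump_ext A X a a' s : framed A X -> (forall x, x \in X -> gen A x -> a x = a' x) ->
  flag_jump A X a s = flag_jump A X a' s.
Proof.
elim: s A X a a' => [|K s IH] A X a a' o e /=.
  case: eqP => // X0; apply: e; first by rewrite mem0v.
  by case: o => _ _ nA; rewrite (nonv0 nA X0).
case: ifP => // hK; apply: IH; first exact: framed_restr hK.
by move=> y yK _; apply: jump_ext => //; apply: subvP (hyps_sub hK) _ yK.
Qed.

Lemma flag_jumpD A X a a' s : flag_jump A X (fun x => a x + a' x) s = flag_jump A X a s + flag_jump A X a' s.
Proof.
elim: s A X a a' => [|K s IH] A X a a' /=; first by case: ifP => _; rewrite ?addr0.
case: ifP => _; last by rewrite addr0.
rewrite -IH; congr flag_jump; apply/funext => y; rewrite /jump; ring.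
Qed.

Lemma flag_jumpZ A X a (m : int) s : flag_jump A X (fun x => a x * m) s = flag_jump A X a s * m.
Proof.
elim: s A X a => [|K s IH] A X a /=; first by case: ifP => _; rewrite ?mul0r.
case: ifP => _; last by rewrite mul0r.
rewrite -IH; congr flag_jump; apply/funext => y; rewrite /jump; ring.
Qed.

Lemma flag_jump0 A X s : flag_jump A X (fun=> 0) s = 0.
Proof. by rewrite -[0 in LHS](mulr0 1) flag_jumpZ mulr0. Qed.

Lemma flag_jump_flag A X a s : flag_jump A X a s != 0 -> flag A X s.
Proof.
elim: s A X a => [|K s IH] A X a /=; first by case: ifP; rewrite ?eqxx.
by case: ifP => [_ /IH|]; rewrite ?eqxx.
Qed.

Lemma flag_jump_sum (I : Type) (r : seq I) (P : pred I) A X (f : I -> V -> int) s :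
  flag_jump A X (fun x => \sum_(i <- r | P i) f i x) s = \sum_(i <- r | P i) flag_jump A X (f i) s.
Proof.
elim: r => [|i r IH].
  rewrite big_nil (_ : (fun=> _) = fun=> 0) ?flag_jump0 //.
  by apply/funext => x; rewrite big_nil.
rewrite big_cons -IH; case: ifP => Pi; last first.
  by congr flag_jump; apply/funext => x; rewrite big_cons Pi.
by rewrite -flag_jumpD; congr flag_jump; apply/funext => x; rewrite big_cons Pi.
Qed.

(** Across a hyperplane of [A] that is not one of [A'], both pushes of a generic point stay in one
    chamber of [A'], so [a] has no jump there. This transports iterated jumps between an arrangement
    and a deletion. *)
Lemma flag_jump_sub A A' X a s : framed A X -> {subset A' <= A} -> inv A' X a ->
  flag_jump A X a s = flag_jump A' X a s.
Proof.
elim: s A A' X a => [|K s IH] A A' X a o sA ia //=.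
have o' := framed_sub o sA.
case: ifP => [hK|/negbT nK]; last first.
  rewrite ifF //; apply: contraNF nK => /hypsP[l /sA lA ->].
  by apply/hypsP; exists l.
have /subvP KX := hyps_sub hK.
have be v y x : beside A y v x -> beside A' y v x.
  by move=> /allP b; apply/allP => l /sA /b.
have ia' : inv A X a by move=> x y xX yX /(same_sub sA); apply: ia.
case: ifP => [hK'|/negbT nK'].
  rewrite -(IH (restr A K) (restr A' K)).
  - apply: flag_jump_ext; first exact: framed_restr hK.
    move=> y /KX yX _; rewrite [RHS](jumpE o' ia yX (framed_push o yX) (framed_pushN o yX)) //.
    + by apply/be/framed_beside.
    + by apply/be/framed_besideN.
  - exact: framed_restr hK.
  - by move=> l; rewrite !mem_filter => /andP[-> /sA].
  - exact: inv_jump.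
rewrite -(flag_jump0 (restr A K) K s); apply: flag_jump_ext; first exact: framed_restr hK.
move=> y yK /allP gy; rewrite /jump; apply/eqP; rewrite subr_eq0; apply/eqP.
have yX := KX _ yK.
have gy' l : l \in A' -> ev l y != 0.
  move=> lA'; apply: gy; rewrite mem_filter sA // andbT.
  apply: contra nK' => Kl; apply/hypsP; exists l => //.
  by case: o => _ _ nA; apply: hyps_ker nA hK (sA _ lA') Kl.
apply: ia; rewrite ?framed_push ?framed_pushN //.
apply: (@beside_same _ _ A' y (n X)); first by apply/be/framed_beside.
apply/allP => l lA'; have := allP (be _ _ _ (framed_besideN y o)) l lA'.
by rewrite (negbTE (gy' l lA')).
Qed.

(** Two pushes: the first, in a direction where [phi] is negative, settles the case [ev phi y = 0];
    the second, along [n X], leaves all kernels. With [phi] in the list, the second push cannot undo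
    the first. *)
Lemma neg_perturb A X y : framed A X -> X != 0%VS -> y \in X -> ev phi y <= 0 ->
  exists2 y', y' \in X & [/\ ev phi y' < 0, gen A y' &
    forall l, l \in A -> ev l y != 0 -> 0 < ev l y * ev l y'].
Proof.
move=> o X0 yX py.
have [v vX pv] : exists2 v, v \in X & ev phi v < 0.
  case: (o) => FX _ _; have /nvanishP[v vX] := phi_gen FX X0.
  rewrite neq_lt => /orP[pv|pv]; first by exists v.
  by exists (- v); rewrite ?memvN // evN oppr_lt0.
pose y1 := push (phi :: A) y v.
have y1X : y1 \in X by apply: push_in.
have py1 : ev phi y1 < 0.
  move: py; rewrite le_eqVlt => /orP[/eqP p0|pn].
    by rewrite /y1 /push evD evZ p0 add0r pmulr_rlt0 // eps_gt0.
  have := @eps_sign _ _ (phi :: A) y v phi (mem_head _ _); rewrite lt_eqF // => /(_ isT).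
  by rewrite nmulr_rgt0.
pose y2 := push (phi :: A) y1 (n X).
have be : beside (phi :: A) y1 (n X) y2.
  apply: push_beside => l; rewrite inE => /orP[/eqP -> p0|lA _]; last exact: framed_n lA.
  by rewrite p0 ltxx in py1.
exists y2; first by apply: push_in => //; case: o => FX _ _; apply: n_in.
have /allP b2 := be; have := beside_gen be => /= /andP[_ g]; split=> //.
  have := b2 phi (mem_head _ _); rewrite lt_eqF //.
  by rewrite nmulr_rgt0.
move=> l lA ny.
have lA' : l \in phi :: A by rewrite inE lA orbT.
have h := eps_sign v lA' ny; rewrite -/y1 in h.
have := b2 l lA'; case: eqP => [e|_]; first by rewrite e mulr0 ltxx in h.
by apply: mul_pos_trans; rewrite mulrC.
Qed.

(** A chamber of [K] that is not positive contains a generic point [w] with [phi < 0]. Pushing [w]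
    off [K] to either side keeps [phi < 0], so [a] vanishes on both adjacent chambers and its jump
    is zero. *)
Lemma chamberfun_jump A X K a : framed A X -> K \in hyps A X -> chamberfun A X a ->
  chamberfun (restr A K) K (jump A X a).
Proof.
move=> o hK [ia pa]; split; first exact: inv_jump.
move=> y yK gy jy y' y'K ny' syy'.
have /subvP KX := hyps_sub hK.
rewrite ltNge; apply/negP => py'.
have oK := framed_restr o hK.
have K0 : K != 0%VS by apply: contraNneq ny' => K0; rewrite K0 memv0 in y'K.
have [w wK [pw gw sw]] := neg_perturb oK K0 y'K py'.
have syw : same (restr A K) y w.
  apply: (same_trans syy'); apply/allP => l lA; apply: sw => //.
  have := allP syy' l lA; apply: contraTneq => ->; by rewrite mulr0 ltxx.
have key v : v \in X -> (forall l, l \in A -> ev l v != 0) -> a (push A y v) = 0.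
  move=> vX gv; apply/eqP; apply: contraT => az.
  have b1 : beside A y v (push A y v) by apply: push_beside => l lA _; apply: gv.
  pose x := push (phi :: A) w v.
  have b2 : beside (phi :: A) w v x.
    apply: push_beside => l; rewrite inE => /orP[/eqP -> p0|lA _]; last exact: gv.
    by rewrite p0 ltxx in pw.
  have xX : x \in X by apply: push_in => //; apply: KX.
  have px : ev phi x < 0.
    have := allP b2 phi (mem_head _ _); rewrite lt_eqF //.
    by rewrite nmulr_rgt0.
  have b3 : beside A y v x.
    apply/allP => l lA; have := allP b2 l; rewrite inE lA orbT => /(_ isT).
    case Kl: (K <= lker l)%VS.
      by rewrite (vanish_ev Kl yK) (vanish_ev Kl wK) eqxx.
    have lr : l \in restr A K by rewrite mem_filter Kl.
    have := allP syw l lr.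
    case: eqP => [->|_]; first by rewrite mulr0 ltxx.
    case: eqP => [->|_]; first by rewrite mul0r ltxx.
    by rewrite mulrC; apply: mul_pos_trans.
  have pyX : push A y v \in X by apply: push_in => //; apply: KX.
  have := pa _ pyX (beside_gen b1) az x xX _ (beside_same b1 b3).
  rewrite lt_gtF //; apply; apply: contraTneq px => ->; by rewrite ev0 ltxx.
have nX : n X \in X by case: o => FX _ _; apply: n_in.
move: jy; rewrite /jump key ?key ?subrr ?eqxx ?memvN //.
- by move=> l lA; apply: framed_nN lA.
- by move=> l lA; apply: framed_n lA.
Qed.

(** * Iterated jumps are cycles *)

Lemma cycB A X c c' : cyc A X c -> cyc A X c' -> cyc A X (fun s => c s - c' s).
Proof.
move=> H; elim: H c' => {}A {}X {}c f1 b1 r1 IH c' [f2 b2 r2]; split.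
- move=> s nz; case: (altP (c s =P 0)) => [e|/f1 //].
  by apply: f2; apply: contraNneq nz => ->; rewrite e subrr.
- by move=> Z s; rewrite sumrB b1 b2 subrr.
- by move=> K hK; apply: (IH K hK); apply: r2.
Qed.

(** The form that cuts out [K0] in [X] also cuts out [Z] in any other hyperplane [K] through [Z], by
    dimension. *)
Lemma hyps_codim2 A X K K0 Z : framed A X -> K \in hyps A X -> K0 \in hyps A X ->
  Z \in hyps (restr A K0) K0 -> (Z <= K)%VS -> Z \in hyps (restr A K) K.
Proof.
move=> o hK hK0 hZ ZK; case: (altP (K =P K0)) => [-> //|nK].
have [_ _ nA] := o.
have dK := dim_hyps nA hK; have dK0 := dim_hyps nA hK0.
have dZ := dim_hyps (nonv_restr A K0) hZ.
have /hypsP[l2 l2A eK0] := hK0.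
have nl2 : ~~ (K <= lker l2)%VS.
  by apply: contra nK => Kl; rewrite eK0; apply/eqP/(hyps_ker nA hK).
apply/hypsP; exists l2; first by rewrite mem_filter nl2.
apply/eqP; rewrite eqEdim subv_cap ZK -(leq_add2l 1) !add1n (dim_cap_ker nl2).
rewrite -(leq_add2l 1) !add1n dK dZ dK0 leqnn andbT /=.
by apply: subv_trans (hyps_sub hZ) _; rewrite eK0 capvSr.
Qed.

(* In the plane transverse to [Z], the hyperplanes through [Z] are lines crossed, in the order
   of their slopes, by both vertical paths [t |-> n K0 + t n X] and [t |-> - n K0 - t n X];
   these two paths have the same end chambers. *)
Lemma sum_jump_jump A X Z a e : framed A X -> inv A X a -> e \in Z -> gen (restr A Z) e ->
  \sum_(K <- hyps A X | Z \in hyps (restr A K) K)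
     jump (restr A K) K (jump A X a) e = 0.
Proof.
move=> o ia eZ ge; rewrite -big_filter; set Ks := [seq K <- _ | _].
case: (altP (Ks =P [::])) => [->|Ks0]; first by rewrite big_nil.
have KsP K : K \in Ks -> K \in hyps A X /\ Z \in hyps (restr A K) K.
  by rewrite mem_filter => /andP[].
have [K0 K0s] : exists K0, K0 \in Ks.
  by case: (Ks) Ks0 => // K ? _; exists K; rewrite mem_head.
have [hK0 hZ0] := KsP _ K0s.
have [FX sA nA] := o.
have [l0 l0A _] := hypsP _ _ _ hK0.
set N := n X; set q := n K0.
have NX : N \in X by apply: n_in.
have hyps0 K : K \in hyps A X -> K \in hyps (restr A0 X) X.
  move=> /hypsP[l lA ->]; apply/hypsP; exists l => //.
  by rewrite mem_filter (allP nA) ?sA.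
(* By [n_coh] all [n K] lie on the line through [q] in direction [N]; [m K] is the coordinate there,
   read off with a form that does not vanish at [N]. *)
pose m K := ev l0 (n K - q) / ev l0 N.
have mE K : K \in Ks -> n K = q + m K *: N.
  move=> /KsP[hK _]; have := n_coh FX (hyps0 _ hK) (hyps0 _ hK0).
  move=> /vlineP[k]; rewrite -/N -/q /m => e1; rewrite e1 evZ mulfK; last exact: (framed_n o).
  by rewrite -e1 addrC subrK.
have nKK K : K \in Ks -> n K \in K.
  by move=> /KsP[hK _]; apply: n_in; case: (framed_restr o hK).
have ZK K : K \in Ks -> (Z <= K)%VS by move=> /KsP[_ /hyps_sub].
pose w t := q + t *: N.
have evw K l t : K \in Ks -> K = (X :&: lker l)%VS -> ev l (w t) = (t - m K) * ev l N.
  move=> Kk eK; have : n K \in (X :&: lker l)%VS by rewrite -eK nKK.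
  rewrite memv_cap => /andP[_]; rewrite mem_ker mE // /w !evD !evZ => /eqP e0.
  by rewrite mulrBl -[LHS]subr0 -e0; ring.
(* Equal slopes would put [n K] into a second hyperplane [K'], although it is generic in [K]. *)
have mI : {in Ks &, injective m}.
  move=> K K' Kk K'k e1; have [hK hZ] := KsP _ Kk; have [hK' hZ'] := KsP _ K'k.
  have nKK' : n K = n K' by rewrite !mE // e1.
  have [l lA eK'] := hypsP _ _ _ hK'.
  case Kl: (K <= lker l)%VS; first by rewrite eK'; apply: hyps_ker nA hK lA Kl.
  have lr : l \in restr A K by rewrite mem_filter Kl.
  have := framed_n (framed_restr o hK) lr; rewrite nKK'.
  have : n K' \in (X :&: lker l)%VS by rewrite -eK' nKK.
  by rewrite memv_cap mem_ker => /andP[_ ->].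
have inKs l : l \in A -> ev l e = 0 -> (X :&: lker l)%VS \in Ks.
  move=> lA le; have hK : (X :&: lker l)%VS \in hyps A X by apply/hypsP; exists l.
  rewrite mem_filter hK andbT; apply: (hyps_codim2 o hK hK0 hZ0).
  rewrite subv_cap (subv_trans (ZK _ K0s) (hyps_sub hK0)) /=.
  by apply: contraT => Zl; have := allP ge l; rewrite mem_filter Zl lA le eqxx => /(_ isT).
have wX t : w t \in X.
  by rewrite memvD ?memvZ // (subvP (hyps_sub hK0)) // nKK.
have eX : e \in X by apply: subvP (hyps_sub hK0) _ (subvP (ZK _ K0s) _ eZ).
(* [sg] selects the path [w] or [- w], and [tau] the side of the time [m K]: one statement covers
   the four chambers that enter the double jump at [e]. *)
have key K (sg tau t : R) : K \in Ks -> sg * sg = 1 -> tau * tau = 1 -> 0 < tau * (t - m K) ->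
    {in Ks, forall K', K' != K -> 0 < (m K - m K') * (t - m K')} ->
    beside A (push (restr A K) e (sg *: n K)) ((tau * sg) *: N) (push A e (sg *: w t)).
  move=> Kk sg1 tau1 tK oth; have [hK hZ] := KsP _ Kk.
  have eK : e \in K by apply: subvP (ZK _ Kk) _ eZ.
  apply/allP => l lA; case: (altP (ev l e =P 0)) => [le0|lne]; last first.
    have lr : l \in restr A K.
      by rewrite mem_filter lA andbT; apply: contra lne => Kl; rewrite (vanish_ev Kl eK).
    have h1 := eps_sign (sg *: n K) lr lne.
    have h2 := eps_sign (sg *: w t) lA lne.
    case: eqP => [e0|_]; first by rewrite e0 mulr0 ltxx in h1.
    exact: mul_pos_trans h1 h2.
  have K'k := inKs l lA le0; set K' := (X :&: lker l)%VS in K'k.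
  have lN : 0 < ev l N * ev l N by rewrite -expr2 exprn_even_gt0 //= (framed_n o).
  rewrite /push.
  have e1 := eps_gt0 (restr A K) e (sg *: n K); set E1 := eps _ _ _ in e1 *.
  have e2 := eps_gt0 A e (sg *: w t); set E2 := eps _ _ _ in e2 *.
  rewrite !evD !evZ le0 !add0r (evw K') // mE // -/(w (m K)) (evw K') //.
  case: (altP (K' =P K)) => [eKK|nKK'].
    rewrite eKK subrr mul0r !mulr0 eqxx.
    rewrite (_ : _ * _ = (sg * sg) * E2 * (tau * (t - m K)) * (ev l N * ev l N)); last by ring.
    by rewrite sg1 mul1r; do 3 ?[apply: mulr_gt0 => //].
  have o1 := oth K' K'k nKK'.
  have pp : 0 < E1 * (sg * ((m K - m K') * ev l N)) * (E2 * (sg * ((t - m K') * ev l N))).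
    rewrite (_ : _ * _ = (sg * sg) * E1 * E2 * ((m K - m K') * (t - m K')) * (ev l N * ev l N));
      last by ring.
    by rewrite sg1 mul1r; do 3 ?[apply: mulr_gt0 => //].
  by case: eqP => [e0|_ //]; rewrite e0 mul0r ltxx in pp.
(* Along [- w] time runs against [N], which flips the sign of the inner jump; the minus sign of the
   outer jump flips it back, hence a sum. *)
pose G t := a (push A e (w t)) + a (push A e (- w t)).
pose T := 1 + \sum_(K <- Ks) `|m K|.
have bd K : K \in Ks -> - T < m K < T.
  move=> Kk; rewrite -ltr_norml /T (big_rem K) //= addrCA ltrDl.
  by rewrite ltr_pwDl // sumr_ge0.
have G0 : G T - G (- T) = 0.
  (* Since [T] exceeds every [|m K|], on the forms vanishing at [e] the vectors [w T] and
     [- w (- T)] have the signs of [N], and [- w T] and [w (- T)] those of [- N]. *)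
  have end_eq v v' u : v \in X -> v' \in X ->
      (forall l, l \in A -> ev l e = 0 -> 0 < ev l u * ev l v /\ 0 < ev l u * ev l v') ->
      a (push A e v) = a (push A e v').
    move=> vX v'X h; apply: ia; rewrite ?push_in //.
    by apply: (@beside_same _ _ A e u); apply: push_beside_dir => l lA /(h l lA)[].
  rewrite /G (end_eq (w T) (- w (- T)) N) ?memvN // ?(end_eq (- w T) (w (- T)) (- N)) ?memvN //.
  - by rewrite [X in X - _]addrC subrr.
  - move=> l lA le; have Kk := inKs l lA le; have /andP[b1 b2] := bd _ Kk.
    have lN : 0 < ev l N * ev l N by rewrite -expr2 exprn_even_gt0 //= (framed_n o).
    rewrite !evN !(evw _ _ _ Kk) //; split; nra.
  - move=> l lA le; have Kk := inKs l lA le; have /andP[b1 b2] := bd _ Kk.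
    have lN : 0 < ev l N * ev l N by rewrite -expr2 exprn_even_gt0 //= (framed_n o).
    rewrite !evN !(evw _ _ _ Kk) //; split; nra.
rewrite -[RHS]G0; apply: (@sum_jumps _ _ m) => //.
  by rewrite filter_uniq // hyps_uniq.
move=> K t t' Kk t'm mt out; have [hK hZ] := KsP _ Kk.
have pX (sg : R) : push (restr A K) e (sg *: n K) \in X.
  by apply: push_in => //; rewrite memvZ // (subvP (hyps_sub hK)) // nKK.
have wX' (sg u : R) : push A e (sg *: w u) \in X by apply: push_in => //; rewrite memvZ.
have out1 : {in Ks, forall K', K' != K -> 0 < (m K - m K') * (t - m K')}.
  move=> K' K'k nK'; case/orP: (out K' K'k nK') => h.
    by rewrite -mulrNN mulr_gt0 // oppr_gt0 subr_lt0 // (lt_trans mt h).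
  by rewrite mulr_gt0 // subr_gt0 ?(lt_trans h) // (lt_trans t'm).
have out2 : {in Ks, forall K', K' != K -> 0 < (m K - m K') * (t' - m K')}.
  move=> K' K'k nK'; case/orP: (out K' K'k nK') => h.
    by rewrite -mulrNN mulr_gt0 // oppr_gt0 subr_lt0 ?(lt_trans mt h) // (lt_trans t'm) // (lt_trans mt h).
  by rewrite mulr_gt0 // subr_gt0 // (lt_trans h).
have k1 (sg : R) : sg * sg = 1 ->
    beside A (push (restr A K) e (sg *: n K)) (sg *: N) (push A e (sg *: w t)).
  by move=> sg1; have := @key K sg 1 t; rewrite !mul1r subr_gt0; apply.
have k2 (sg : R) : sg * sg = 1 ->
    beside A (push (restr A K) e (sg *: n K)) (- sg *: N) (push A e (sg *: w t')).
  by move=> sg1; have := @key K sg (-1) t'; rewrite !mulN1r opprK opprB subr_gt0; apply.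
have m1 : (-1) * (-1) = 1 :> R by rewrite mulrNN mulr1.
have := k2 1 (mulr1 1); have := k1 1 (mulr1 1); have := k2 (-1) m1; have := k1 (-1) m1.
have := wX' 1 t; have := wX' 1 t'; have := wX' (-1) t; have := wX' (-1) t'.
have := pX 1; have := pX (-1).
rewrite opprK !scale1r !scaleN1r => h1 h2 h3 h4 h5 h6 h7 h8 h9 h10.
rewrite [LHS]/jump (jumpE o ia h2 h6 h5 h9 h10) (jumpE o ia h1 h3 h4 h8 h7) /G; ring.
Qed.

(** The arrangement induced on [Z] does not depend on the [K] through which [Z] is reached, so
    linearity moves the sum over [K] inside the remaining jumps, where [sum_jump_jump] makes it
    vanish at generic points. *)
Lemma cyc_flag_jump A X a : framed A X -> inv A X a -> cyc A X (flag_jump A X a).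
Proof.
move: {2}(\dim X).+1 (leqnn (\dim X).+1) => k.
elim: k A X a => [|k IH] A X a; first by rewrite ltn0.
move=> dk o ia.
have [_ _ nA] := o; split.
- by move=> s; apply: flag_jump_flag.
- move=> Z s.
  have -> : \sum_(K <- hyps A X) flag_jump A X a [:: K, Z & s] =
      \sum_(K <- hyps A X | Z \in hyps (restr A K) K)
        flag_jump (restr A Z) Z (jump (restr A K) K (jump A X a)) s.
    rewrite [RHS]big_mkcond /= big_seq [RHS]big_seq; apply: eq_bigr => K hK.
    by rewrite hK; case: ifP => // hZ; rewrite restr_restr // (hyps_sub hZ).
  rewrite -flag_jump_sum.
  have [/hasP[K hK hZ]|/hasPn no] :=
    boolP (has (fun K => Z \in hyps (restr A K) K) (hyps A X)); last first.
    rewrite -[RHS](flag_jump0 (restr A Z) Z s); congr flag_jump; apply/funext => e.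
    by rewrite big_seq_cond big_pred0 // => K; apply/negbTE; rewrite negb_and -implybE;
      apply/implyP; apply: no.
  rewrite -[RHS](flag_jump0 (restr A Z) Z s); apply: flag_jump_ext.
    by rewrite -(restr_restr _ (hyps_sub hZ)); apply: framed_restr hZ; apply: framed_restr hK.
  by move=> e eZ ge; apply: sum_jump_jump.
- move=> K hK /=.
  have -> : (fun s => if K \in hyps A X then flag_jump (restr A K) K (jump A X a) s else 0) =
    flag_jump (restr A K) K (jump A X a) by apply/funext => s; rewrite hK.
  apply: IH; first by rewrite (dim_hyps nA hK).
    exact: framed_restr hK.
  exact: inv_jump.
Qed.

(** * Deleting one hyperplane *)

Lemma ev_hyp A X l l2 x : framed A X -> l \in A -> (X :&: lker l <= lker l2)%VS -> x \in X ->
  ev l2 x = ev l x / ev l (n X) * ev l2 (n X).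
Proof.
move=> o lA sl xX; have lN := framed_n o lA.
have : x - (ev l x / ev l (n X)) *: n X \in (X :&: lker l)%VS.
  rewrite memv_cap mem_ker evB evZ divfK // subrr eqxx andbT.
  by rewrite memvB // memvZ // n_in //; case: o.
by move=> /(subvP sl); rewrite mem_ker evB evZ subr_eq0 => /eqP.
Qed.

(** All forms removed by the deletion are multiples of [l] on [X], by [ev_hyp], so the sign of [l]
    alone decides theirs. *)
Lemma same_hyp A X l x x' : framed A X -> l \in A -> x \in X -> x' \in X ->
  same (restr A (X :&: lker l)) x x' -> 0 < ev l x * ev l x' -> same A x x'.
Proof.
move=> o lA xX x'X /allP sr pl; apply/allP => l2 l2A.
case sl: ((X :&: lker l) <= lker l2)%VS; last by apply: sr; rewrite mem_filter sl.
have lN := framed_n o lA; have l2N := framed_n o l2A.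
rewrite (ev_hyp o lA sl xX) (ev_hyp o lA sl x'X).
rewrite (_ : _ * _ = (ev l x * ev l x') * (ev l2 (n X) / ev l (n X)) ^+ 2); last first.
  by field.
by rewrite mulr_gt0 // exprn_even_gt0 //= mulf_neq0 // invr_neq0.
Qed.

Lemma beside_hyp A X l p v x : framed A X -> l \in A -> p \in (X :&: lker l)%VS ->
  v \in X -> x \in X -> same (restr A (X :&: lker l)) p x -> 0 < ev l v * ev l x ->
  beside A p v x.
Proof.
move=> o lA pK vX xX /allP sr pl; apply/allP => l2 l2A.
case sl: ((X :&: lker l) <= lker l2)%VS; last first.
  have lr : l2 \in restr A (X :&: lker l) by rewrite mem_filter sl.
  by have := sr l2 lr; case: eqP => [->|//]; rewrite mul0r ltxx.
have lN := framed_n o lA; have l2N := framed_n o l2A.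
rewrite (vanish_ev sl pK) eqxx (ev_hyp o lA sl xX) (ev_hyp o lA sl vX).
rewrite (_ : _ * _ = (ev l v * ev l x) * (ev l2 (n X) / ev l (n X)) ^+ 2); last first.
  by field.
by rewrite mulr_gt0 // exprn_even_gt0 //= mulf_neq0 // invr_neq0.
Qed.

Lemma crossing A X l x x' : x \in X -> x' \in X -> same A x x' -> ev l x * ev l x' < 0 ->
  exists al be, [/\ 0 < al, 0 < be, al *: x + be *: x' \in (X :&: lker l)%VS &
    same A x (al *: x + be *: x')].
Proof.
(* Up to scale this is the point where the segment from [x] to [x'] meets the kernel of [l]: the
   values of [l] have opposite signs and these weights cancel them. *)
move=> xX x'X sxx neg; exists `|ev l x'|, `|ev l x|.
have [n1 n2] : ev l x != 0 /\ ev l x' != 0.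
  by split; apply: contraTneq neg => ->; rewrite ?mul0r ?mulr0 ltxx.
split; rewrite ?normr_gt0 //.
  rewrite memv_cap memvD ?memvZ //= mem_ker evD !evZ.
  case: (ltrgt0P (ev l x)) n1 => // h1 _; case: (ltrgt0P (ev l x')) n2 => // h2 _.
  - by have := mulr_gt0 h1 h2; rewrite ltNge ltW.
  - by apply/eqP; ring.
  - by apply/eqP; ring.
  - by move: neg; rewrite nmulr_rlt0 // lt_gtF.
apply/allP => l2 l2A; have h := allP sxx l2 l2A.
rewrite evD !evZ mulrDr mulrCA (mulrCA _ `|ev l x|); apply: ltr_wpDl.
  by rewrite mulr_ge0 // -expr2 sqr_ge0.
by rewrite mulr_gt0 ?normr_gt0.
Qed.

Lemma restr_size A X l : l \in A -> (size (restr A (X :&: lker l)) < size A)%N.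
Proof.
move=> lA; rewrite size_filter -[X in (_ < X)%N](count_predC (fun l' => ~~ (X :&: lker l <= lker l')%VS)).
rewrite -addn1 leq_add2l -has_count; apply/hasP; exists l => //=.
by rewrite negbK capvSr.
Qed.

(* The push moves the points of [K], which are generic for the deletion, off [K]. *)
Lemma chamberfun_del A X K a : framed A X -> K \in hyps A X -> chamberfun A X a ->
  (forall y, y \in K -> gen (restr A K) y -> jump A X a y = 0) ->
  chamberfun (restr A K) X (fun x => a (push A x (n X))) /\
  forall x, x \in X -> gen A x -> a (push A x (n X)) = a x.
Proof.
move=> o hK [ia pa] j0; have [l lA eK] := hypsP _ _ _ hK.
subst K; set K := (X :&: lker l)%VS in hK j0 *.
have nX : n X \in X by case: o => FX _ _; apply: n_in.
(* [K] cuts a chamber of the deletion into at most two chambers of [A]; the vanishing jump at a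
   point [p] of [K] between them equates the two values. *)
have crossed x x' : x \in X -> x' \in X -> gen A x -> gen A x' ->
    same (restr A K) x x' -> a x = a x'.
  have half u u' : u \in X -> u' \in X -> same (restr A K) u u' ->
      0 < ev l (n X) * ev l u -> ev l (n X) * ev l u' < 0 -> a u = a u'.
    move=> uX u'X suu pu nu'.
    have neg : ev l u * ev l u' < 0.
      have lN : 0 < ev l (n X) ^+ 2 by rewrite exprn_even_gt0 //= (framed_n o).
      have e : ev l (n X) ^+ 2 * (ev l u * ev l u') =
        (ev l (n X) * ev l u) * (ev l (n X) * ev l u') by ring.
      by rewrite -(pmulr_rlt0 _ lN) e pmulr_rlt0.
    have [al [be [_ _ pK sp]]] := crossing uX u'X suu neg.
    set p := _ + _ in pK sp.
    have pX : p \in X by move: pK; rewrite memv_cap => /andP[].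
    have gp : gen (restr A K) p by apply: same_genr sp.
    apply/eqP; rewrite -subr_eq0 -(jumpE o ia pX uX u'X) ?j0 //.
    - by apply: (beside_hyp o lA pK nX uX); rewrite // same_sym.
    - apply: (beside_hyp o lA pK _ u'X); first by rewrite memvN.
        by apply: same_trans suu; rewrite same_sym.
      by rewrite evN mulNr oppr_gt0.
  move=> xX x'X gx gx' sxx.
  have [h|h] := ltP 0 (ev l x * ev l x').
    by apply: ia => //; apply: (same_hyp o lA).
  have nx := allP gx l lA; have nx' := allP gx' l lA; have nN := framed_n o lA.
  have lN : 0 < ev l (n X) ^+ 2 by rewrite exprn_even_gt0.
  have : (ev l (n X) * ev l x) * (ev l (n X) * ev l x') < 0.
    have -> : (ev l (n X) * ev l x) * (ev l (n X) * ev l x') =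
      ev l (n X) ^+ 2 * (ev l x * ev l x') by ring.
    by rewrite pmulr_rlt0 // lt_neqAle h mulf_neq0.
  case: (ltrgt0P (ev l (n X) * ev l x)) => [h1|h1|h1].
  - by rewrite pmulr_rlt0 // => h2; apply: half.
  - by rewrite nmulr_rlt0 // => h2; apply/esym; apply: half; rewrite // same_sym.
  - by rewrite h1 mul0r ltxx.
have pushK x : gen (restr A K) x -> same (restr A K) x (push A x (n X)).
  move=> /allP gx; apply/allP => l2 l2r.
  by apply: eps_sign; [apply: restr_sub l2r | apply: gx].
have pushG x : gen A (push A x (n X)) by apply: beside_gen (framed_beside x o).
have inv' x y : x \in X -> y \in X -> same (restr A K) x y ->
    a (push A x (n X)) = a (push A y (n X)).
  move=> xX yX sxy; apply: crossed; rewrite ?push_in //.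
  have gx := same_gen sxy; have gy := same_genr sxy.
  apply: same_trans (pushK y gy); apply: same_trans sxy.
  by rewrite same_sym pushK.
split; last first.
  move=> x xX gx; apply: crossed; rewrite ?push_in // same_sym pushK //.
  by apply: gen_sub gx; apply: restr_sub.
(* A point with [phi <= 0] in the chamber of the deletion yields a point [w] of that chamber,
   generic for [A], with [phi < 0]; there [a] has the same nonzero value, against its positivity. *)
split=> // x xX gx az y yX ny sxy; rewrite ltNge; apply/negP => py.
have X0 : X != 0%VS by apply: contraNneq ny => X0; rewrite X0 memv0 in yX.
have [w wX [pw gw sw]] := neg_perturb o X0 yX py.
have syw : same (restr A K) y w.
  have gy := same_genr sxy.
  by apply/allP => l2 l2r; apply: sw; [apply: restr_sub l2r | apply: (allP gy)].
have aw : a w = a (push A x (n X)).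
  apply: crossed; rewrite ?push_in //.
  apply: same_trans (pushK x gx); rewrite same_sym.
  exact: same_trans syw.
have nw : w != 0 by apply: contraTneq pw => ->; rewrite ev0 ltxx.
have := pa w wX gw; rewrite aw => /(_ az w wX nw (same_refl gw)).
by rewrite lt_gtF.
Qed.

(** The induction is used twice on the shorter list [restr A K]: in [K] it shows that [a] does not
    jump across [K], and in [X] it applies to the function induced on the deletion, which has the
    same iterated jumps. *)
Lemma flag_jump_inj A X a : framed A X -> chamberfun A X a -> (forall s, flag_jump A X a s = 0) ->
  forall x, x \in X -> gen A x -> a x = 0.
Proof.
have [k] := ubnP (size A); elim: k A X a => // k IH A X a sk o ca d0 x xX gx.
case: (altP (A =P [::])) => [A0'|].
  case: (altP (X =P 0%VS)) => [X0|X0].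
    by have := d0 [::]; rewrite /= X0 eqxx; move: xX; rewrite X0 memv0 => /eqP ->.
  apply/eqP; apply: contraT => az.
  have [_ /(_ x xX gx az) px] := ca.
  have vX := memv_pick X; have nv : vpick X != 0 by rewrite vpick0.
  set v := vpick X in vX nv; rewrite A0' in px.
  have := px v vX nv isT; have := px (- v); rewrite memvN oppr_eq0 => /(_ vX nv isT).
  by rewrite evN oppr_gt0 => /lt_trans h /h; rewrite ltxx.
move=> An; have [l lA] : exists l, l \in A.
  by case: (A) An => // l A1 _; exists l; rewrite mem_head.
set K := (X :&: lker l)%VS; have hK : K \in hyps A X by apply/hypsP; exists l.
have sz : (size (restr A K) < k)%N by apply: leq_trans (restr_size X lA) _.
have j0 y : y \in K -> gen (restr A K) y -> jump A X a y = 0.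
  apply: IH => //; first exact: framed_restr hK.
    exact: chamberfun_jump.
  by move=> s; have := d0 (K :: s); rewrite /= hK.
have [ca' e] := chamberfun_del o hK ca j0.
have sr := @restr_sub _ _ A K.
rewrite -e //; apply: (IH (restr A K) X (fun x => a (push A x (n X)))) => //.
- exact: framed_sub sr.
- move=> s; by rewrite -(flag_jump_sub s o sr (proj1 ca')) -[RHS](d0 s); apply: flag_jump_ext.
- exact: gen_sub gx.
Qed.

(** * Support of iterated jumps, and surjectivity *)

Lemma flag_sub A X s Y : flag A X s -> Y \in s -> (Y <= X)%VS.
Proof.
elim: s A X => [//|K s IH] A X /= /andP[hK fK]; rewrite inE => /orP[/eqP ->|/(IH _ _ fK)].
  exact: hyps_sub hK.
by move=> YK; apply: subv_trans YK (hyps_sub hK).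
Qed.

(** A nonzero jump at a point forces a nonzero value at one of its two pushes, and pushes preserve
    nonzero signs. For the indicator of a chamber, [y] is then a point of the closure that is
    generic in [Y], so that [Y] is the span of a face. *)
Lemma flag_jump_supp A X a s Y : framed A X -> flag_jump A X a s != 0 -> Y \in s ->
  exists y x, [/\ y \in Y, gen (restr A Y) y, x \in X, gen A x & a x != 0] /\
    forall l, l \in A -> ev l y != 0 -> 0 < ev l y * ev l x.
Proof.
elim: s A X a => [//|K s IH] A X a o; rewrite /=; case: ifP => [hK|]; rewrite ?eqxx // => dn.
have /subvP KX := hyps_sub hK.
have lift y : y \in K -> jump A X a y != 0 -> exists x, [/\ x \in X, gen A x, a x != 0 &
    forall l, l \in A -> ev l y != 0 -> 0 < ev l y * ev l x].
  move=> /KX yX jn.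
  case: (altP (a (push A y (n X)) =P 0)) => [e|an].
    exists (push A y (- n X)); split.
    - exact: framed_pushN.
    - exact: beside_gen (framed_besideN y o).
    - by apply: contraNneq jn => e'; rewrite /jump e e' subrr.
    - by move=> l lA; apply: eps_sign.
  exists (push A y (n X)); split=> //.
  - exact: framed_push.
  - exact: beside_gen (framed_beside y o).
  - by move=> l lA; apply: eps_sign.
rewrite inE => /orP[/eqP ->|Ys].
  have [y [yK gy jn]] : exists y, [/\ y \in K, gen (restr A K) y & jump A X a y != 0].
    apply: contrapT => no; case/negP: dn; apply/eqP.
    rewrite -[RHS](flag_jump0 (restr A K) K s); apply: flag_jump_ext; first exact: framed_restr hK.
    move=> y yK gy; apply/eqP; apply: contraT => jn; case: no; by exists y.
  have [x [xX gx an sx]] := lift y yK jn.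
  by exists y, x.
have YK : (Y <= K)%VS by apply: flag_sub Ys; apply: flag_jump_flag dn.
have [y [x1 [[yY gy x1K gx1 jn] sx1]]] := IH _ _ _ (framed_restr o hK) dn Ys.
have [x [xX gx an sx]] := lift x1 x1K jn.
exists y, x; rewrite restr_restr // in gy; split=> // l lA ly.
have lr : l \in restr A K.
  rewrite mem_filter lA andbT; apply: contra ly => Kl.
  by rewrite (vanish_ev Kl) // (subvP YK).
have h1 := sx1 l lr ly.
have h2 : 0 < ev l x1 * ev l x.
  by apply: sx => //; apply: contraTneq h1 => ->; rewrite mulr0 ltxx.
by apply: mul_pos_trans h2; rewrite mulrC.
Qed.

(* A positive chamber of the restriction to [K] separates two chambers of [A], one of which is
   positive: points with [phi <= 0] in both would be joined by a segment crossing [K]. *)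
Lemma chamberfun_lift A X K b : framed A X -> K \in hyps A X -> chamberfun (restr A K) K b ->
  exists2 a, chamberfun A X a &
    forall y, y \in K -> gen (restr A K) y -> jump A X a y = b y.
Proof.
move=> o hK [ib pb]; have [l lA eK] := hypsP _ _ _ hK.
set A' := restr A K in ib pb *; set N := n X.
have NX : N \in X by case: o => FX _ _; apply: n_in.
have lN : ev l N != 0 by apply: framed_n o lA.
have sA' : {subset A' <= A} by apply: restr_sub.
pose adj x := [set y | y \in K /\ same A' x y]%classic.
pose up x := 0 < ev l N * ev l x.
pose P y := forall x, x \in X -> same A' y x -> up x -> 0 < ev phi x.
(* A jump is the upper minus the lower value, so [b y] goes on the upper half if that half is
   positive, and [- b y] on the lower half otherwise. Chambers of the deletion that miss [K] get
   [0]. *)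
pose val x y := if `[<P y>] then (if up x then b y else 0) else (if up x then 0 else - b y).
pose a x := if `[<exists y, adj x y>] then val x (xget 0 (adj x)) else 0.
have PE y y' : same A' y y' -> P y -> P y'.
  by move=> syy Py x xX sx; apply: Py => //; apply: same_trans sx.
have aE x y : adj x y -> a x = val x y.
  move=> h; have ex : exists y, adj x y by exists y.
  have [y'K sy'] := xgetPex 0 ex; move: (xget 0 _) y'K sy' => y' y'K sy'.
  have [yK sy] := h; rewrite /a asboolT //.
  have syy : same A' y y' by apply: same_trans sy'; rewrite same_sym.
  have be : b (xget 0 (adj x)) = b y.
    have [zK sz] := xgetPex 0 ex; apply: ib => //.
    by apply: same_trans sy; rewrite same_sym.
  rewrite /val be; congr (if _ then _ else _).
  have [zK sz] := xgetPex 0 ex.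
  by apply/asboolP/asboolP; apply: PE; [apply: same_trans sy|apply: same_trans sz];
    rewrite same_sym.
have upE x x' : same A x x' -> up x = up x'.
  move=> sx; have h := allP sx l lA; rewrite /up; apply/idP/idP => hu.
    by apply: mul_pos_trans h; rewrite mulrC.
  by apply: (@mul_pos_trans _ (ev l x')); rewrite mulrC.
exists a; last first.
  move=> y yK gy; have yX := subvP (hyps_sub hK) _ yK.
  have ly : ev l y = 0 by move: yK; rewrite eK memv_cap mem_ker => /andP[_ /eqP].
  have ad v : adj (push A y v) y.
    split=> //; apply/allP => l2 l2A; rewrite mulrC; apply: eps_sign; first exact: sA'.
    exact: (allP gy).
  have ll : 0 < ev l N * ev l N by rewrite -expr2 exprn_even_gt0.
  have u1 : up (push A y N) by rewrite /up evD evZ ly add0r mulrCA mulr_gt0 // eps_gt0.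
  have u2 : up (push A y (- N)) = false.
    rewrite /up evD evZ ly add0r evN mulrN mulrN oppr_gt0 mulrCA.
    by apply: lt_gtF; rewrite mulr_gt0 // eps_gt0.
  rewrite /jump (aE _ _ (ad N)) (aE _ _ (ad (- N))) /val u1 u2.
  by case: ifP => _; rewrite ?subr0 ?sub0r ?opprK.
split.
  move=> x x' xX x'X sxx.
  have adE y : adj x y -> adj x' y.
    move=> [yK sy]; split=> //; apply: same_trans sy.
    by rewrite same_sym; apply: same_sub sxx.
  case: (pselect (exists y, adj x y)) => [[y h]|no].
    by rewrite (aE _ _ h) (aE _ _ (adE _ h)) /val (upE _ _ sxx).
  rewrite /a asboolF // asboolF // => -[y [yK sy]]; apply: no; exists y; split=> //.
  by apply: same_trans sy; apply: same_sub sxx.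
move=> x xX gx az x1 x1X nx1 sx1.
have [y [yK sy]] : exists y, adj x y.
  by apply: contrapT => no; move: az; rewrite /a asboolF ?eqxx.
have syx1 : same A' y x1.
  by apply: same_trans (same_sub sA' sx1); rewrite same_sym.
move: az; rewrite (aE x y (conj yK sy)) /val; case: asboolP => [Py|nP].
  by case: ifP => [ux _|]; rewrite ?eqxx //; apply: Py => //; rewrite -(upE _ _ sx1).
case: ifP => [|ux]; rewrite ?eqxx // oppr_eq0 => bn.
have py := pb y yK (same_genr sy) bn.
have [x2 [x2X syx2 ux2 px2]] : exists x2, [/\ x2 \in X, same A' y x2, up x2 & ev phi x2 <= 0].
  apply: contrapT => no; apply: nP => x2 x2X sx2 ux2; rewrite ltNge; apply/negP => px2.
  by apply: no; exists x2.
rewrite ltNge; apply/negP => px1.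
have sx12 : same A' x1 x2 by apply: same_trans syx2; rewrite same_sym.
have n1 := allP (same_genr sx1) l lA.
have neg : ev l x1 * ev l x2 < 0.
  rewrite ltNge; apply/negP => ge0.
  have nz2 : ev l x2 != 0 by apply: contraTneq ux2 => e; rewrite /up e mulr0 ltxx.
  have gt0 : 0 < ev l x2 * ev l x1 by rewrite lt_neqAle eq_sym mulf_neq0 //= mulrC.
  move: ux; rewrite (upE _ _ sx1) => /negP; apply; rewrite /up.
  by apply: (@mul_pos_trans _ (ev l x2)) => //; rewrite mulrC.
have [al [be [al0 be0 pK sp]]] := crossing x1X x2X sx12 neg.
have pphi : ev phi (al *: x1 + be *: x2) = al * ev phi x1 + be * ev phi x2.
  by rewrite evD !evZ.
set p := _ + _ in pK sp pphi; rewrite -eK in pK.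
(* [positive] says nothing at [0]. The case [p = 0] forces [K = 0], so [X] is a line; there [phi] is
   a multiple of [l] that vanishes at [x1], hence zero on [X]. *)
case: (altP (p =P 0)) => [p0|pn]; last first.
  have := py p pK pn (same_trans syx1 sp).
  by rewrite pphi ltNge -[X in _ <= X]addr0 lerD // pmulr_rle0.
have A'0 : A' = [::].
  move: sp; rewrite p0; case: (A') => // l2 ? /andP[].
  by rewrite ev0 mulr0 ltxx.
have K0 : K = 0%VS.
  apply/eqP; apply: contraT => Kn.
  have vK := memv_pick K; have nv : vpick K != 0 by rewrite vpick0.
  set v := vpick K in vK nv; rewrite A'0 in py.
  have := py v vK nv isT; have := py (- v); rewrite memvN oppr_eq0 => /(_ vK nv isT).
  by rewrite evN oppr_gt0 => /lt_trans h /h; rewrite ltxx.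
have px0 : ev phi x1 = 0.
  apply: le_anti; rewrite px1 /=; move: pphi; rewrite p0 ev0 => e0.
  rewrite leNgt; apply/negP => h.
  have h1 : al * ev phi x1 < 0 by rewrite pmulr_rlt0.
  have h2 : be * ev phi x2 <= 0 by rewrite pmulr_rle0.
  by have := ltr_leD h1 h2; rewrite -e0 addr0 ltxx.
have sphi : (X :&: lker l <= lker phi)%VS by rewrite -eK K0 sub0v.
have FX : Fl X by case: o.
have X0 : X != 0%VS by apply: contraNneq nx1 => X0; rewrite X0 memv0 in x1X.
have /negP := phi_gen FX X0; apply; apply/subvP => x' x'X; rewrite mem_ker.
rewrite (ev_hyp o lA sphi x'X); move: px0; rewrite (ev_hyp o lA sphi x1X) => /eqP.
rewrite !mulf_eq0 (negbTE n1) invr_eq0 (negbTE lN) /= => /eqP ->.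
by rewrite eqxx orbT.
Qed.

(** The disjunction makes the induction pass to a hyperplane [K']: the trace of [K] on [K'] may
    still be cut out by a form of [A']. If it is not, no hyperplane of [A'] other than [K'] contains
    the trace, the balance there has the single term of [K'], and this term is zero. *)
Lemma cyc_del A A' X K c : nonv A X -> {subset A' <= A} ->
  (forall l, l \in A -> l \notin A' -> (X :&: lker l)%VS = K) ->
  K \in hyps A' X \/ (forall s, c (K :: s) = 0) ->
  cyc A X c -> cyc A' X c.
Proof.
move=> nA sA dK cK H; elim: H A' K nA sA dK cK => {}A {}X {}c fl bal rec IH A' K nA sA dK cK.
have hA K1 : K1 \in hyps A' X -> K1 \in hyps A X.
  by move=> /hypsP[l /sA lA ->]; apply/hypsP; exists l.
have off K1 s : K1 \in hyps A X -> K1 \notin hyps A' X -> c (K1 :: s) = 0.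
  move=> /hypsP[l lA e1] nK1.
  have lA' : l \notin A' by apply: contra nK1 => lA'; apply/hypsP; exists l.
  case: cK => [hK|cK]; last by rewrite e1 dK // cK.
  by case/negP: nK1; rewrite e1 (dK l).
have recK K' : K' \in hyps A' X -> cyc (restr A' K') K' (fun s => c (K' :: s)).
  move=> hK'; apply: (IH K' (hA _ hK') _ (K' :&: K)%VS).
  - exact: nonv_restr.
  - by move=> l; rewrite !mem_filter => /andP[-> /sA].
  - move=> l; rewrite !mem_filter => /andP[nl lA]; rewrite nl /= => lA'.
    rewrite -(dK l lA lA') capvA; congr capv; apply/esym/capv_idPl.
    exact: hyps_sub hK'.
  - case: (boolP ((K' :&: K)%VS \in hyps (restr A' K') K')) => [|nK'']; first by left.
    right=> s; apply/eqP; apply: contraT => nz.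
    have := fl _ nz => /= /andP[_ /andP[hK'' _]].
    have dK'' := dim_hyps (nonv_restr A K') hK''.
    have inter l2 : l2 \in A' -> (X :&: lker l2)%VS != K' ->
        ((K' :&: K) <= lker l2)%VS -> False.
      move=> l2A' neq sub; case/negP: nK''.
      have nl2 : ~~ (K' <= lker l2)%VS.
        by apply: contra neq => h; rewrite -(hyps_ker nA (hA _ hK') (sA _ l2A') h).
      apply/hypsP; exists l2; first by rewrite mem_filter nl2.
      apply/eqP; rewrite eqEdim subv_cap capvSl sub /=.
      by rewrite -(leq_add2l 1) !add1n (dim_cap_ker nl2) dK''.
    case: (altP (K =P K')) => [e|nKK'].
      by move: dK''; rewrite e capvv => /eqP; rewrite -{2}[\dim K']addn0 -addn1 eqn_add2l.
    case: cK => [hK|cK].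
      have [l2 l2A' e2] := hypsP _ _ _ hK.
      by case: (inter l2 l2A'); rewrite -?e2 //; apply: subv_trans (capvSr _ _) _;
        rewrite e2 capvSr.
    have := bal (K' :&: K)%VS s; rewrite (bigD1_seq K') ?hA ?hyps_uniq //=.
    rewrite big_seq_cond big1 ?addr0 => [e|K2 /andP[hK2 nK2]]; first by rewrite e eqxx in nz.
    apply/eqP; apply: contraT => nz2.
    have := fl _ nz2 => /= /andP[_ /andP[h2 _]].
    case: (boolP (K2 \in hyps A' X)) => [/hypsP[l2 l2A' e2]|n2]; last first.
      by rewrite (off _ _ hK2 n2) eqxx in nz2.
    case: (inter l2 l2A'); rewrite -?e2 //.
    by apply: subv_trans (hyps_sub h2) _; rewrite e2 capvSr.
split=> //.
- move=> [|K1 s] nz; have := fl _ nz => //= /andP[h1 _].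
  case: (boolP (K1 \in hyps A' X)) => [h1'|n1]; last by rewrite (off _ _ h1 n1) eqxx in nz.
  by case: (recK _ h1') => + _ _; apply.
- move=> Z s; rewrite -[RHS](bal Z s) [RHS](bigID (mem (hyps A' X))) /=.
  rewrite [X in _ = _ + X]big_seq_cond [X in _ = _ + X]big1 => [|K1 /andP[h1 n1]]; last first.
    exact: off.
  rewrite addr0 -[RHS]big_filter; apply: perm_big; apply: uniq_perm.
  + exact: hyps_uniq.
  + by rewrite filter_uniq // hyps_uniq.
  + by move=> K1; rewrite mem_filter; apply/esym/andb_idr; apply: hA.
Qed.

(** Restriction to [K] gives [b] with the prescribed jumps, and [a1] lifts it. The difference of [c]
    and the iterated jump of [a1] vanishes on flags through [K], so it is a cycle of the deletion
    and comes from some [a2] there; positivity for the deletion implies positivity on the smaller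
    chambers of [A]. *)
Lemma flag_jump_surj A X c : framed A X -> cyc A X c ->
  exists2 a, chamberfun A X a & forall s, flag_jump A X a s = c s.
Proof.
have [k] := ubnP (size A); elim: k A X c => // k IH A X c sk o cc.
case: (altP (A =P [::])) => [A0'|An].
  have [fl _ _] := cc.
  case: (altP (X =P 0%VS)) => [X0|X0].
    exists (fun=> c [::]).
      by split=> // x _ _ _ y yX; move: yX; rewrite X0 memv0 => ->.
    move=> [|K s] /=; first by rewrite X0 eqxx.
    rewrite A0' /=; apply/eqP; rewrite eq_sym; apply: contraT => /fl.
    by rewrite A0'.
  exists (fun=> 0); first by split=> // x; rewrite eqxx.
  move=> s; rewrite flag_jump0; apply/eqP; rewrite eq_sym; apply: contraT => /fl.
  by rewrite A0'; case: s => //= /eqP e; rewrite e eqxx in X0.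
have [l lA] : exists l, l \in A.
  by case: (A) An => // l A1 _; exists l; rewrite mem_head.
set K := (X :&: lker l)%VS; have hK : K \in hyps A X by apply/hypsP; exists l.
have sz : (size (restr A K) < k)%N by apply: leq_trans (restr_size X lA) _.
have sr := @restr_sub _ _ A K.
have [FX sA nA] := o.
have [b cb Db] := IH _ K _ sz (framed_restr o hK) (let: Cyc _ _ r := cc in r K hK).
have [a1 ca1 j1] := chamberfun_lift o hK cb.
have Da1 s : flag_jump A X a1 (K :: s) = c (K :: s).
  by rewrite /= hK -Db; apply: flag_jump_ext => //; apply: framed_restr hK.
have cc2 : cyc (restr A K) X (fun s => c s - flag_jump A X a1 s).
  apply: (@cyc_del A (restr A K) X K _ nA sr).
  - move=> l2 l2A; rewrite mem_filter l2A andbT negbK => Kl.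
    by apply/esym; apply: hyps_ker nA hK l2A Kl.
  - by right=> s; rewrite Da1 subrr.
  - by apply: cycB cc _; apply: cyc_flag_jump o _; case: ca1.
have [a2 [ia2 pa2] Da2] := IH _ X _ sz (framed_sub o sr) cc2.
have ia2' : inv A X a2 by move=> x y xX yX /(same_sub sr); apply: ia2.
exists (fun x => a1 x + a2 x); last first.
  by move=> s; rewrite flag_jumpD (flag_jump_sub s o sr ia2) Da2 addrC subrK.
case: ca1 => ia1 pa1; split.
  by move=> x y xX yX sxy; rewrite (ia1 x y) ?(ia2' x y).
move=> x xX gx; case: (altP (a1 x =P 0)) => [->|n1 _]; last exact: pa1.
rewrite add0r => n2 y yX ny sxy; apply: (pa2 x) => //; first exact: gen_sub gx.
exact: same_sub sxy.
Qed.

End Framed.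

(** * Coherent transverse vectors *)

Section Framing.
Variables (R : realFieldType) (V : vectType R).
Local Notation form := 'Hom(V, R^o).
Implicit Types (l : form) (X Y K Z : {vspace V}) (x y u v : V).

Lemma form_neq0 v : v != 0 -> exists l : form, ev l v != 0.
Proof.
move=> nv; pose e := vbasis {: V}.
have [[i ni]|no] := pselect (exists i, coord e i v != 0).
  exists (linfun (coord e i : V -> R^o)).
  by rewrite /ev lfunE.
case/negP: nv; apply/eqP; rewrite (coord_vbasis (memvf v)) big1 // => i _.
suff -> : coord (vbasis fullv) i v = 0 by rewrite scale0r.
by apply/eqP; apply: contraT => ni; case: no; exists i.
Qed.

Lemma form_avoid (vs : seq V) : all (fun v => v != 0) vs ->
  exists l : form, all (fun v => ev l v != 0) vs.
Proof.
elim: vs => [|v vs IH] /=; first by exists 0.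
move=> /andP[nv /IH[f /allP fvs]].
have [g gv] := form_neq0 nv.
(* [t1] will exceed every [|ev f w / ev g w|], so [f + t1 *: g] can vanish at such a [w] only if [g]
   does; but then [w] is in [vs], where [f] is nonzero. *)
pose t : R := 1 + \sum_(w <- vs) `|ev f w / ev g w|.
have t0 : 0 < t by rewrite ltr_pwDl // sumr_ge0.
pose t1 := t + `|ev f v / ev g v|.
have evl w : ev (f + t1 *: g) w = ev f w + t1 * ev g w.
  by rewrite /ev add_lfunE scale_lfunE.
have key w : `|ev f w / ev g w| < t1 -> ev g w != 0 -> ev f w + t1 * ev g w != 0.
  move=> lt ng; apply: contraTneq lt => /eqP; rewrite addr_eq0 => /eqP ->.
  by rewrite mulNr mulfK // normrN -leNgt ler_norm.
exists (f + t1 *: g); rewrite evl key ?ltrDr //=; apply/allP => w wvs; rewrite evl.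
have [->|ng] := eqVneq (ev g w) 0; first by rewrite mulr0 addr0 fvs.
apply: key => //; rewrite /t1 /t (big_rem w) //= addrCA -addrA ltrDl.
by rewrite -addrA ltr_pwDl // addr_ge0 // sumr_ge0.
Qed.

Definition flagker (f : nat -> form) (j : nat) := (\bigcap_(i < j) lker (f i))%VS.

(** Each new form avoids one chosen vector in every nonzero intersection obtained so far, so each
    drops by one dimension; truncated subtraction covers those that are already zero. *)
Lemma generic_flag (Fs : seq {vspace V}) k : exists f : nat -> form,
  forall j Y, (j <= k)%N -> Y \in Fs -> \dim (Y :&: flagker f j) = (\dim Y - j)%N.
Proof.
elim: k => [|k [f fP]].
  exists (fun=> 0) => j Y; rewrite leqn0 => /eqP -> _.
  by rewrite /flagker big_ord0 capvf subn0.
pose Ys := [seq Y <- Fs | (Y :&: flagker f k)%VS != 0%VS].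
have [|l /allP lP] := @form_avoid [seq vpick (Y :&: flagker f k)%VS | Y <- Ys].
  by apply/allP => v /mapP[Y]; rewrite mem_filter => /andP[nY _] ->; rewrite vpick0.
pose f' i := if i == k then l else f i.
have fk j : (j <= k)%N -> flagker f' j = flagker f j.
  move=> jk; apply: eq_bigr => i _; rewrite /f' ifF //.
  by apply/negbTE; rewrite neq_ltn (leq_trans (ltn_ord i) jk).
exists f' => j Y; rewrite leq_eqVlt => /orP[/eqP ->|jk] YF; last by rewrite fk ?fP.
rewrite [flagker _ _](_ : _ = (flagker f k :&: lker l)%VS); last first.
  have f'k : f' k = l by rewrite /f' eqxx.
  by rewrite -(fk k) // -f'k /flagker big_ord_recr.
rewrite capvA; case: (altP ((Y :&: flagker f k)%VS =P 0%VS)) => [e0|nz].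
  have := fP k Y (leqnn k) YF; rewrite e0 cap0v dimv0 => /esym e.
  by apply/esym/eqP; rewrite subnS e.
have nl : ~~ ((Y :&: flagker f k) <= lker l)%VS.
  apply/nvanishP; exists (vpick (Y :&: flagker f k)%VS); first exact: memv_pick.
  by apply: lP; apply/mapP; exists Y; rewrite // mem_filter nz.
have := dim_cap_ker nl; rewrite fP // subnS => <-; by rewrite succnK.
Qed.

(** The first [\dim Y - 1] forms of the flag cut [Y] in a line, which misses every hyperplane of
    [Y]; [n Y] is the vector of this line on which the next form is [1]. For hyperplanes [K], [K']
    of [Y] the normalising form is the last one defining the line of [Y], so it kills
    [n K - n K']. *)
Lemma framing_exists (Fs : seq {vspace V}) (A0 : seq form) :
  (forall Y l, Y \in Fs -> l \in A0 -> (Y :&: lker l)%VS \in Fs) ->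
  exists n : {vspace V} -> V, [/\ (forall Y, Y \in Fs -> n Y \in Y),
    (forall Y l, Y \in Fs -> l \in A0 -> ~~ (Y <= lker l)%VS -> ev l (n Y) != 0) &
    (forall Y K K', Y \in Fs -> K \in hyps (restr A0 Y) Y ->
       K' \in hyps (restr A0 Y) Y -> n K - n K' \in <[n Y]>%VS)].
Proof.
move=> Fcap; have [f fP] := generic_flag Fs (\dim {: V}).
have dle Y : (\dim Y <= \dim {: V})%N by apply/dimvS/subvf.
pose k Y := (\dim Y).-1.
pose u Y := vpick (Y :&: flagker f (k Y))%VS.
pose n Y := (ev (f (k Y)) (u Y))^-1 *: u Y.
have uY Y : u Y \in (Y :&: flagker f (k Y))%VS by apply: memv_pick.
have nY Y : n Y \in (Y :&: flagker f (k Y))%VS by rewrite memvZ.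
have kle Y : (k Y <= \dim {: V})%N by apply: leq_trans (leq_pred _) _.
have kS Y : Y != 0%VS -> (k Y).+1 = \dim Y by move=> Y0; rewrite prednK // lt0n dimv_eq0.
have dim1 Y : Y \in Fs -> Y != 0%VS -> \dim (Y :&: flagker f (k Y)) = 1%N.
  by move=> YF Y0; rewrite fP // -(kS Y Y0) subSnn.
have kerS j : flagker f j.+1 = (flagker f j :&: lker (f j))%VS.
  by rewrite /flagker big_ord_recr.
have n1 Y : Y \in Fs -> Y != 0%VS -> ev (f (k Y)) (n Y) = 1.
  move=> YF Y0; rewrite evZ mulVf //; apply: contraT; rewrite negbK => e0.
  have : u Y \in (Y :&: flagker f (\dim Y))%VS.
    by rewrite -kS // kerS capvA memv_cap uY mem_ker.
  have : (Y :&: flagker f (\dim Y))%VS == 0%VS by rewrite -dimv_eq0 fP // subnn.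
  move=> /eqP ->; rewrite memv0 vpick0 => /eqP e.
  by have := dim1 Y YF Y0; rewrite e dimv0.
exists n; split.
- by move=> Y _; have := nY Y; rewrite memv_cap => /andP[].
- move=> Y l YF lA nl; apply/negP => e0.
  have Y0 : Y != 0%VS by apply: contraNneq nl => ->; apply: sub0v.
  have := dim_cap_ker nl; rewrite -(kS Y Y0) => -[dk].
  have : n Y \in ((Y :&: lker l) :&: flagker f (k Y))%VS.
    by have := nY Y; rewrite !memv_cap mem_ker e0 => /andP[-> ->].
  have : ((Y :&: lker l) :&: flagker f (k Y))%VS == 0%VS.
    by rewrite -dimv_eq0 fP ?Fcap // dk subnn.
  move=> /eqP ->; rewrite memv0 => /eqP nY0; have := n1 Y YF Y0.
  by rewrite nY0 ev0 => /eqP; rewrite eq_sym oner_eq0.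
- move=> Y K K' YF hK hK'.
  have mF L : L \in hyps (restr A0 Y) Y -> L \in Fs.
    by move=> /hypsP[l /restr_sub lA ->]; apply: Fcap.
  have dK := dim_hyps (nonv_restr A0 Y) hK; have dK' := dim_hyps (nonv_restr A0 Y) hK'.
  have Y0 : Y != 0%VS by rewrite -dimv_eq0 -dK.
  have ek : k Y = \dim K by rewrite /k -dK.
  have ek' : k Y = \dim K' by rewrite /k -dK'.
  have eY : (<[n Y]> == Y :&: flagker f (k Y))%VS.
    rewrite eqEdim -memvE nY dim1 // dim_vline.
    by case: eqP (n1 Y YF Y0) => // ->; rewrite ev0 => /eqP; rewrite eq_sym oner_eq0.
  rewrite (eqP eY).
  case: (altP (K =P 0%VS)) => [K0|K0].
    have K'0 : K' = 0%VS by apply/eqP; rewrite -dimv_eq0 -ek' ek K0 dimv0.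
    by rewrite K0 K'0 subrr mem0v.
  have K'0 : K' != 0%VS by rewrite -dimv_eq0 -ek' ek dimv_eq0.
  have kK : k Y = (k K).+1 by rewrite kS.
  have kK' : k K' = k K by apply: succn_inj; rewrite kS // -ek' kK.
  have [/andP[nK1 nK2] /andP[nK'1 nK'2]] :
      (n K \in K) && (n K \in flagker f (k K)) /\ (n K' \in K') && (n K' \in flagker f (k K)).
    by have := nY K; have := nY K'; rewrite !memv_cap kK'.
  rewrite memv_cap kK kerS memv_cap mem_ker evB n1 ?mF // -kK' n1 ?mF // subrr eqxx andbT.
  rewrite memvB ?(subvP (hyps_sub hK) _ nK1) ?(subvP (hyps_sub hK') _ nK'1) //=.
  by rewrite kK' memvB.
Qed.

End Framing.

(** * Flags and cycles without recursion *)

Section NonRecursive.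
Variables (R : realFieldType) (V : vectType R).
Local Notation form := 'Hom(V, R^o).
Implicit Types (l : form) (A : seq form) (X Y K Z : {vspace V}) (s : seq {vspace V}).
Implicit Types (c : seq {vspace V} -> int).
Variables (Fs : seq {vspace V}) (A0 : seq form).
Hypothesis Fs_uniq : uniq Fs.
Hypothesis Fs_cap : forall Y l, Y \in Fs -> l \in A0 -> (Y :&: lker l)%VS \in Fs.
Hypothesis Fs_hyps : forall X K, X \in Fs -> K \in Fs -> (K <= X)%VS ->
  (\dim K).+1 = \dim X -> K \in hyps (restr A0 X) X.

Definition facet_step X Y := [&& Y \in Fs, (Y <= X)%VS & (\dim Y).+1 == \dim X].

Lemma hyps_step X K : X \in Fs -> (K \in hyps (restr A0 X) X) = facet_step X K.
Proof.
move=> XF; apply/idP/and3P => [hK|[KF KX /eqP dK]]; last exact: Fs_hyps.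
split; [|exact: hyps_sub hK|by rewrite (dim_hyps (nonv_restr A0 X) hK)].
by case/hypsP: hK => l /restr_sub lA ->; apply: Fs_cap.
Qed.

Lemma flag_path X s : X \in Fs ->
  flag (restr A0 X) X s = path facet_step X s && (last X s == 0%VS).
Proof.
elim: s X => [//|K s IH] X XF /=; rewrite hyps_step //.
case hK: (facet_step X K) => //=; have /and3P[KF KX _] := hK.
by rewrite restr_restr // IH.
Qed.

(** Summing over all of [Fs] makes the range independent of the position in the flag; the extra
    terms vanish because [c] is supported on flags. *)
Lemma sum_hyps X c : X \in Fs -> (forall s, c s != 0 -> flag (restr A0 X) X s) ->
  forall s, \sum_(Y <- Fs) c (Y :: s) = \sum_(K <- hyps (restr A0 X) X) c (K :: s).
Proof.
move=> XF fl s; rewrite (bigID (mem (hyps (restr A0 X) X))) /= [X in _ + X]big1.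
  rewrite addr0 -big_filter; apply: perm_big; apply: uniq_perm.
  - exact: filter_uniq.
  - exact: hyps_uniq.
  - move=> K; rewrite mem_filter hyps_step //; apply: andb_idr => /and3P[] //.
move=> Y nY; apply/eqP; apply: contraT => /fl /=.
by rewrite (negbTE nY).
Qed.

Lemma cyc_balanced X c : X \in Fs -> cyc (restr A0 X) X c ->
  forall s1 Z s2, \sum_(Y <- Fs) c (s1 ++ Y :: Z :: s2) = 0.
Proof.
move=> XF cc s1; elim: s1 X c XF cc => [|K s1 IH] X c XF [fl bal rec] Z s2 /=.
  by rewrite (sum_hyps XF fl).
case: (boolP (K \in hyps (restr A0 X) X)) => [hK|nK]; last first.
  rewrite big1 // => Y _; apply/eqP; apply: contraT => /fl /=.
  by rewrite (negbTE nK).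
have := rec K hK; move: hK; rewrite hyps_step // => /and3P[KF KX _].
rewrite restr_restr // => cK; exact: (IH K _ KF cK).
Qed.

Lemma balanced_cyc X c : X \in Fs -> (forall s, c s != 0 -> flag (restr A0 X) X s) ->
  (forall s1 Z s2, \sum_(Y <- Fs) c (s1 ++ Y :: Z :: s2) = 0) -> cyc (restr A0 X) X c.
Proof.
move: {2}(\dim X).+1 (leqnn (\dim X).+1) => k.
elim: k X c => [|k IH] X c; first by rewrite ltn0.
move=> dk XF fl bal; split; first exact: fl.
  by move=> Z s; rewrite -(sum_hyps XF fl); apply: (bal [::]).
move=> K hK; have fl' s : c (K :: s) != 0 -> flag (restr A0 K) K s.
  move=> /fl /= /andP[_]; rewrite restr_restr //; exact: hyps_sub hK.
rewrite (restr_restr _ (hyps_sub hK)).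
have := hK; rewrite (hyps_step K XF) => /and3P[KF _ /eqP dK].
apply: (IH K _ _ KF fl'); first by rewrite dK.
by move=> s1 Z s2; apply: (bal (K :: s1)).
Qed.

Lemma path_dim X s : path (fun X Y => (Y <= X)%VS && (\dim Y < \dim X)%N) X s ->
  (size s + \dim (last X s) <= \dim X)%N.
Proof.
elim: s X => [//|K s IH] X /= /andP[/andP[_ dK] /IH h].
by rewrite addSn (leq_ltn_trans h).
Qed.

(** As many strict drops as the dimension allows must all be drops by one. *)
Lemma path_facet_step X s : path (fun X Y => (Y <= X)%VS && (\dim Y < \dim X)%N) X s ->
  size s = \dim X -> {subset s <= Fs} -> path facet_step X s.
Proof.
elim: s X => [//|K s IH] X /= /andP[/andP[KX dK] p] sz sF.
have := path_dim p => h.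
have eK : size s = \dim K.
  by apply/eqP; rewrite eqn_leq (leq_trans (leq_addr _ _) h) -ltnS sz.
rewrite IH //; last by move=> Y Ys; apply: sF; rewrite inE Ys orbT.
by rewrite andbT /facet_step KX -sz eK eqxx sF ?mem_head.
Qed.

Lemma facet_step_sub X s : path facet_step X s -> {subset s <= Fs}.
Proof.
elim: s X => [//|K s IH] X /= /andP[/and3P[KF _ _] p] Y.
by rewrite inE => /orP[/eqP -> //|]; apply: IH p Y.
Qed.

Lemma facet_step_dim X s i : path facet_step X s -> (i < size s)%N ->
  (\dim (nth X s i) + i.+1 = \dim X)%N.
Proof.
elim: s X i => [//|K s IH] X [|i] /= /andP[/and3P[_ _ /eqP dK] p]; first by rewrite addn1.
by rewrite ltnS => h; rewrite (set_nth_default K) // addnS IH.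
Qed.

End NonRecursive.

(** * Cycles of the order complex *)

Lemma hyperplane_form (R : realFieldType) (V : vectType R) (K : {vspace V}) :
  (\dim K).+1 = \dim {: V} -> exists l : 'Hom(V, R^o), lker l = K.
Proof.
move=> dK; have dC : \dim (K^C)%VS = 1%N by rewrite dimv_compl -dK subSnn.
set w := vpick (K^C)%VS.
have wC : w \in (K^C)%VS by apply: memv_pick.
have w0 : w != 0 by rewrite vpick0 -dimv_eq0 dC.
have [g gw] := form_neq0 w0.
have eC : (<[w]> == K^C)%VS by rewrite eqEdim -memvE wC dim_vline w0 dC.
exists (g \o (\1 - projv K))%VF; apply/vspaceP => x.
have -> : (x \in lker (g \o (\1 - projv K))%VF) = (ev g (x - projv K x) == 0).
  by rewrite memv_ker comp_lfunE add_lfunE opp_lfunE id_lfunE.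
apply/idP/idP => [|xK]; last by rewrite projv_id // subrr ev0.
have := memv_projC K x; rewrite -(eqP eC) => /vlineP[t e].
rewrite e evZ mulf_eq0 (negbTE gw) orbF => /eqP t0.
by move/eqP: e; rewrite t0 scale0r subr_eq0 => /eqP ->; apply: memv_proj.
Qed.

Lemma mem_bigcapv (F : fieldType) (V : vectType F) (I : eqType) (r : seq I) (U : I -> {vspace V}) x :
  reflect (forall i, i \in r -> x \in U i) (x \in (\bigcap_(i <- r) U i)%VS).
Proof.
elim: r => [|i r IH]; first by rewrite big_nil memvf; apply: ReflectT.
rewrite big_cons memv_cap; apply: (iffP andP) => [[xi /IH xr] j|h].
  by rewrite inE => /orP[/eqP ->|/xr].
split; first by apply: h; rewrite mem_head.
by apply/IH => j jr; apply: h; rewrite inE jr orbT.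
Qed.

Section GradedBoundary.
Variables (T : finType) (x0 : T) (k : nat) (c : {ffun k.-tuple T -> int}).

Lemma size_omit i (s : seq T) : (i < size s)%N -> size (omit i s) = (size s).-1.
Proof.
move=> h; rewrite size_cat size_take h size_drop; case: (size s) h => // m h.
by rewrite subSS subnKC.
Qed.

Lemma nth_omit i j (s : seq T) : (i < size s)%N ->
  nth x0 (omit i s) j = nth x0 s (if j < i then j else j.+1)%N.
Proof.
move=> h; rewrite nth_cat size_take h; case: ltnP => ji; first exact: nth_take.
by rewrite nth_drop addSn subnKC.
Qed.

Lemma omit_insert i (s : seq T) : (i < size s)%N ->
  s = take i (omit i s) ++ nth x0 s i :: drop i (omit i s).
Proof.
move=> h; have st : size (take i s) = i by rewrite size_take h.
rewrite /omit take_size_cat // drop_size_cat //.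
by rewrite -drop_nth // cat_take_drop.
Qed.

Lemma insert_omit i y (u : seq T) : (i <= size u)%N ->
  omit i (take i u ++ y :: drop i u) = u.
Proof.
move=> h; have st : size (take i u) = i by rewrite size_takel.
rewrite /omit take_size_cat // -cat_rcons drop_size_cat ?cat_take_drop //.
by rewrite size_rcons st.
Qed.

Lemma sum_omit i (u : k.-1.-tuple T) (F : seq T -> int) : (i < k)%N ->
  \sum_(t : k.-tuple T | omit i t == u :> seq T) F t =
  \sum_(y : T) F (take i u ++ y :: drop i u).
Proof.
move=> ik; have iu : (i <= size u)%N by rewrite size_tuple -ltnS (ltn_predK ik).
have szk y : size (take i u ++ y :: drop i u) == k.
  by rewrite size_cat /= addnS -size_cat cat_take_drop size_tuple (ltn_predK ik).
rewrite (reindex (fun y => Tuple (szk y))) /=.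
  by apply: eq_bigl => y; rewrite insert_omit // eqxx.
exists (fun t : k.-tuple T => nth x0 t i) => [y _|t /eqP e] /=.
  by rewrite nth_cat size_takel // ltnn subnn.
apply: val_inj => /=.
by rewrite -e -omit_insert // size_tuple.
Qed.

(* In a graded poset the position of the omitted element of a maximal chain is determined. *)
Lemma boundary_graded (rk : T -> nat) m :
  (forall t, c t != 0 -> forall j, (j < k)%N -> (rk (nth x0 t j) + j.+1 = m)%N) ->
  forall (u : k.-1.-tuple T) (t0 : k.-tuple T) (i0 : nat), (i0 < k)%N -> c t0 != 0 ->
  omit i0 t0 = u -> boundary c u = (-1) ^+ i0 * \sum_(t : k.-tuple T | omit i0 t == u) c t.
Proof.
move=> gr u t0 i0 ik nz0 e0; rewrite ffunE big_distrr /= [RHS]big_mkcond /=.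
(* For [i < i'], entry [i] of [u] is entry [i.+1] of [t] and entry [i] of [t'], which have different
   ranks. *)
have clash (t t' : k.-tuple T) i i' : c t != 0 -> c t' != 0 -> (i < i')%N -> (i' < k)%N ->
    omit i t = u :> seq T -> omit i' t' = u :> seq T -> False.
  move=> nt nt' ii ik' e e'; have i1k : (i.+1 < k)%N by apply: leq_ltn_trans ik'.
  have := gr t nt i.+1 i1k; have := gr t' nt' i (ltn_trans ii ik').
  have := nth_omit i (s := t) (i := i); rewrite size_tuple ltnn => /(_ (ltnW i1k)) <-.
  have := nth_omit i (s := t') (i := i'); rewrite size_tuple ii => /(_ ik') <-.
  by rewrite e e' => <- /eqP; rewrite eqn_add2l -[i.+2]addn1 -[X in _ == X]addn0 eqn_add2l.
apply: eq_bigr => t _; have [ct0|nt] := eqVneq (c t) 0.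
  by rewrite big1 => [|i _]; rewrite ct0 mulr0 ?if_same.
case: ifP => [/eqP e|/negbT ne].
  rewrite (big_pred1 (Ordinal ik)) // => i /=; apply/eqP/eqP => [ei|->] //.
  apply: val_inj => /=; case: (ltngtP i i0) => // h.
    by case: (clash t t0 i i0 nt nz0 h ik ei e0).
  by case: (clash t0 t i0 i nz0 nt h (ltn_ord i) e0 ei).
rewrite big_pred0 // => i; apply/negP => /eqP ei.
case: (ltngtP i i0) => h.
- by case: (clash t t0 i i0 nt nz0 h ik ei e0).
- by case: (clash t0 t i0 i nz0 nt h (ltn_ord i) e0 ei).
- by case/negP: ne; rewrite -h ei.
Qed.

End GradedBoundary.

(** * Top homology of the lattice as functions on flags *)

Section Bridge.
Variables (R : realType) (d : nat) (A : {fset {vspace 'rV[R]_d}}).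
Local Notation V := 'rV[R]_d.
Local Notation T := (intersections A).
Hypothesis hA : hyperplane_arrangement A.
Hypothesis eA : essential A.
Hypothesis d_gt0 : (0 < d)%N.

Lemma dim_rV : \dim {: V} = d.
Proof. by rewrite dimvf dim_matrix; apply: mul1n. Qed.

Lemma dim_lt_full (X : {vspace V}) : X != {: V}%VS -> (\dim X < d)%N.
Proof.
move=> xf; rewrite -[X in (_ < X)%N]dim_rV ltn_neqAle dimvS ?subvf // andbT.
by apply: contra xf => /eqP e; rewrite eqEdim subvf e leqnn.
Qed.

Definition hform (K : {vspace V}) : 'Hom(V, R^o) := xget 0 [set l | lker l = K].
Definition hforms := [seq hform K | K <- enum_fset A].

Lemma ker_hform K : K \in A -> lker (hform K) = K.
Proof.
move=> KA; have : exists l : 'Hom(V, R^o), [set l | lker l = K] l.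
  by apply: hyperplane_form; rewrite hA // dim_rV.
by move=> /(xgetPex 0).
Qed.

Lemma hformsP l : l \in hforms -> exists2 K, K \in A & l = hform K.
Proof. by move=> /mapP[K KA ->]; exists K. Qed.

Lemma hform_in K : K \in A -> hform K \in hforms.
Proof. by move=> KA; apply: map_f. Qed.

Lemma hforms_nonv : nonv hforms {: V}.
Proof.
apply/allP => l /hformsP[K KA ->]; rewrite ker_hform //; apply/negP => /dimvS.
have lt : (\dim K < d)%N by rewrite (hA KA).
by rewrite dim_rV leqNgt lt.
Qed.

Lemma intersectionsP X : reflect
  (exists2 B : {fset {vspace V}}, (B `<=` A)%fset & X = (\bigcap_(K <- B) K)%VS)
  (X \in T).
Proof.
apply/(iffP idP) => [/imfsetP[B] /= | [B BA ->]].
  by rewrite fpowersetE => BA ->; exists B.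
by apply/imfsetP; exists B; rewrite //= fpowersetE.
Qed.

Lemma full_intersections : {: V}%VS \in T.
Proof. by apply/intersectionsP; exists fset0; rewrite ?fsub0set // big_seq_fset0. Qed.

Lemma zero_intersections : 0%VS \in T.
Proof. by apply/intersectionsP; exists A; rewrite ?fsubset_refl // eA. Qed.

Lemma intersections_cap Y K : Y \in T -> K \in A -> (Y :&: K)%VS \in T.
Proof.
move=> /intersectionsP[B BA ->] KA; apply/intersectionsP; exists (K |` B)%fset.
  by apply/fsubsetP => L; rewrite in_fset1U => /orP[/eqP ->|/(fsubsetP BA)].
apply/vspaceP => x; rewrite memv_cap; apply/andP/mem_bigcapv => [[/mem_bigcapv xB xK] L|h].
  by rewrite in_fset1U => /orP[/eqP ->|/xB].
split; last by apply: h; rewrite fset1U1.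
by apply/mem_bigcapv => L LB; apply: h; rewrite in_fset1U LB orbT.
Qed.

Lemma intersections_ker Y l : Y \in T -> l \in hforms -> (Y :&: lker l)%VS \in T.
Proof. by move=> YT /hformsP[K KA ->]; rewrite ker_hform // intersections_cap. Qed.

Lemma intersections_flat Y x : Y \in T -> (forall l, l \in hforms -> (Y <= lker l)%VS -> ev l x = 0) ->
  x \in Y.
Proof.
move=> /intersectionsP[B BA eY] h; rewrite eY; apply/mem_bigcapv => K KB.
have KA := fsubsetP BA K KB; rewrite -(ker_hform KA) mem_ker h ?hform_in //.
rewrite ker_hform // eY; apply/subvP => y /mem_bigcapv; exact.
Qed.

Lemma intersections_hyps X K : X \in T -> K \in T -> (K <= X)%VS ->
  (\dim K).+1 = \dim X -> K \in hyps (restr hforms X) X.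
Proof.
move=> XT KT KX dK.
have [l lA /andP[Kl nX]] : exists2 l, l \in hforms & (K <= lker l)%VS && ~~ (X <= lker l)%VS.
  apply: contrapT => no; have : (X <= K)%VS.
    apply/subvP => x xX; apply: intersections_flat => // l lA Kl; apply: (vanish_ev _ xX).
    by apply: contraT => nX; case: no; exists l; rewrite // Kl.
  by move=> /dimvS; rewrite -dK ltnn.
apply/hypsP; exists l; first by rewrite mem_filter nX.
apply/eqP; rewrite eqEdim subv_cap KX Kl /= -ltnS dK.
by rewrite (dim_cap_ker nX).
Qed.

Local Notation k := d.-1.
Local Notation step := (facet_step (enum_fset T)).

Lemma in_Lbar (x : T) : (x \in Lbar A) = (val x != {: V}%VS) && (val x != 0%VS).
Proof. by rewrite !inE. Qed.

(** A chain of [d.-1] proper flats becomes a complete flag in the sense of [flag], which omits the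
    ambient space but includes the final zero space. *)
Definition emb (t : seq T) : seq {vspace V} := rcons (map val t) 0%VS.

Lemma emb_inj : injective emb.
Proof. by move=> t t' /rcons_inj[] /(inj_map val_inj). Qed.

Lemma emb_path (t : k.-tuple T) : sorted (@latt_lt R d A) t -> all (fun x => x \in Lbar A) t ->
  path step {: V}%VS (emb t).
Proof.
move=> srt /allP inL; apply: path_facet_step.
- rewrite /emb rcons_path sub0v /= dimv0 lt0n dimv_eq0.
  case: t srt inL => -[|x t] /= szt srt inL.
    by rewrite -dimv_eq0 dim_rV -lt0n d_gt0.
  apply/andP; split; last first.
    have : last x t \in x :: t by apply: mem_last.
    by move=> /inL; rewrite last_map in_Lbar => /andP[].
  rewrite subvf dim_rV /=; apply/andP; split.
    have := inL x (mem_head _ _); rewrite in_Lbar => /andP[xf _].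
    exact: dim_lt_full.
  elim: t x srt {szt inL} => [//|y t IH] x /= /andP[/andP[nxy yx] p].
  rewrite yx IH // andbT /= ltn_neqAle dimvS // andbT.
  by apply: contra nxy => /eqP e; rewrite eq_sym eqEdim yx e leqnn.
- by rewrite size_rcons size_map size_tuple dim_rV prednK.
- move=> Y; rewrite mem_rcons inE => /orP[/eqP ->|/mapP[x _ ->]].
    exact: zero_intersections.
  exact: fsvalP.
Qed.

Lemma step_emb s : path step {: V}%VS s -> last {: V}%VS s = 0%VS ->
  exists t : k.-tuple T, [/\ s = emb t, sorted (@latt_lt R d A) t & all (fun x => x \in Lbar A) t].
Proof.
case/lastP: s => [_ /= /eqP|s Z]; first by rewrite -dimv_eq0 dim_rV eqn0Ngt d_gt0.
rewrite last_rcons => p Z0; rewrite {}Z0 in p *.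
have pall Y : Y \in s -> Y \in T.
  by move=> Ys; apply: (facet_step_sub p); rewrite mem_rcons inE Ys orbT.
have [t et] : exists t : seq T, s = map val t.
  elim: s pall {p} => [|Y s IH] h; first by exists [::].
  have [|t ->] := IH; first by move=> W Ws; apply: h; rewrite inE Ws orbT.
  by exists ([` h Y (mem_head _ _)]%fset :: t).
have sz : size (rcons s 0%VS) = d.
  have := facet_step_dim p (i := size s); rewrite size_rcons ltnSn => /(_ isT).
  by rewrite nth_rcons ltnn eqxx dimv0 add0n dim_rV.
have szt : size t == k by have := congr1 predn sz; rewrite et size_rcons size_map /= => ->.
exists (Tuple szt); split=> //=; first by rewrite et.
  move: p; rewrite et rcons_path => /andP[+ _].
  case: (t) => //= x t' /andP[_]; elim: t' x => [//|y t' IH] x /= /andP[/and3P[_ yx dy] p].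
  rewrite IH // andbT /latt_lt yx andbT; apply: contraTneq dy => ->.
  by rewrite -[X in _ != X]addn0 -addn1 eqn_add2l.
apply/allP => x xt.
have xs : val x \in s by rewrite et map_f.
have := facet_step_dim p (i := index (val x) s).
rewrite size_rcons ltnS index_size nth_rcons index_mem xs nth_index // dim_rV => /(_ isT) dx.
rewrite in_Lbar; apply/andP; split.
  by apply: contraTneq isT => e; move: dx; rewrite e dim_rV => /eqP; rewrite -[X in _ == X]addn0 eqn_add2l.
apply: contraTneq isT => e; move: dx; rewrite e dimv0 add0n => ei.
have := etrans ei (esym sz); rewrite size_rcons => -[ei'].
by move: xs; rewrite -index_mem e ei' ltnn.
Qed.

(** Extension by zero: [emb] is injective, so the sum has at most one term. *)
Definition ext (c : {ffun k.-tuple T -> int}) (s : seq {vspace V}) : int :=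
  \sum_(t : k.-tuple T | emb t == s) c t.

Lemma extE c (t : k.-tuple T) : ext c (emb t) = c t.
Proof.
rewrite /ext (big_pred1 t) // => t' /=.
by rewrite (inj_eq emb_inj).
Qed.

Lemma ext_neq0 c s : ext c s != 0 -> exists2 t : k.-tuple T, s = emb t & c t != 0.
Proof.
move=> nz; have [t /eqP e] : exists t : k.-tuple T, emb t == s.
  apply: contrapT => no; case/negP: nz; rewrite /ext big_pred0 // => t.
  by apply/negP => e; apply: no; exists t.
by exists t => //; rewrite -extE e.
Qed.

Lemma restr_full : restr hforms {: V}%VS = hforms.
Proof. by apply/all_filterP; apply: hforms_nonv. Qed.

Lemma flag_step s : flag hforms {: V}%VS s = path step {: V}%VS s && (last {: V}%VS s == 0%VS).
Proof.
rewrite -{1}restr_full; apply: flag_path; first exact: intersections_ker.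
  exact: intersections_hyps.
exact: full_intersections.
Qed.

Lemma chain_flag c (t : k.-tuple T) : c \in @chain_group T (@latt_lt R d A) (Lbar A) k ->
  c t != 0 -> flag hforms {: V}%VS (emb t).
Proof.
move=> /forallP /(_ t) /implyP h /h /andP[srt inL].
by rewrite flag_step emb_path // /emb last_rcons eqxx.
Qed.

Lemma chain_rank c x0 : c \in @chain_group T (@latt_lt R d A) (Lbar A) k ->
  forall t, c t != 0 -> forall j, (j < k)%N -> (\dim (val (nth x0 t j)) + j.+1 = d)%N.
Proof.
move=> cc t nz j jk; have := chain_flag cc nz; rewrite flag_step => /andP[p _].
have := facet_step_dim p (i := j); rewrite size_rcons size_map size_tuple dim_rV.
rewrite nth_rcons size_map size_tuple jk (nth_map x0) ?size_tuple //.
by apply; apply: ltnW.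
Qed.

(** A chain [t0] in the support of [c] fixes the position of the gap in [u]; the boundary
    coefficient is then, up to sign, a sum over fillings as in [cyc_balanced]. Without such a [t0]
    the coefficient is zero anyway. *)
Lemma boundary_ext c (u : k.-1.-tuple T) (t0 : k.-tuple T) i0 :
  c \in @chain_group T (@latt_lt R d A) (Lbar A) k -> (i0 < k)%N -> c t0 != 0 ->
  omit i0 t0 = u ->
  boundary c u = (-1) ^+ i0 * \sum_(Y <- enum_fset T)
    ext c (map val (take i0 u) ++ Y :: rcons (map val (drop i0 u)) 0%VS).
Proof.
move=> cc ik nz e; pose x0 : T := [` full_intersections]%fset.
pose rk (x : T) := \dim (val x).
rewrite (@boundary_graded _ x0 _ c rk d (chain_rank x0 cc) u t0 i0 ik nz e); congr (_ * _).
under eq_bigr do rewrite -extE.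
rewrite (sum_omit x0 u (fun s => ext c (emb s)) ik) big_seq_fsetE /=.
apply: eq_bigr => y _; congr ext.
by rewrite /emb map_cat rcons_cat.
Qed.

Lemma cycle_cyc c : c \in @cycles T (@latt_lt R d A) (Lbar A) k -> cyc hforms {: V}%VS (ext c).
Proof.
move=> /andP[cc /eqP bc]; rewrite -restr_full.
have F1 := intersections_ker; have F2 := intersections_hyps.
apply: (balanced_cyc (fset_uniq T) F1 F2 full_intersections).
  by move=> s /ext_neq0[t -> nz]; rewrite restr_full; apply: chain_flag cc nz.
move=> s1 Z s2; apply/eqP; apply: contraT => nzs.
have [Y0 nzY] : exists Y0, ext c (s1 ++ Y0 :: Z :: s2) != 0.
  apply: contrapT => no; case/negP: nzs; rewrite big1 // => Y _.
  by apply/eqP; apply: contraT => nY; case: no; exists Y.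
have [t0 et nz0] := ext_neq0 nzY.
pose i0 := size s1.
have szs : (size s1 + (size s2).+2 = k.+1)%N.
  by have := congr1 size et; rewrite size_cat /= size_rcons size_map size_tuple.
(* The entry [Z] follows the gap, so the gap is not at the zero space appended by [emb]. *)
have ik : (i0 < k)%N by rewrite -ltnS -szs !addnS !ltnS leq_addr.
have szu : size (omit i0 t0) == k.-1 by rewrite size_omit size_tuple.
have := boundary_ext (u := Tuple szu) cc ik nz0 erefl.
rewrite bc ffunE => /esym /eqP; rewrite mulf_eq0 signr_eq0 /=.
have st : size (take i0 t0) = i0 by rewrite size_take size_tuple ik.
rewrite /omit take_size_cat // drop_size_cat //.
have e1 : map val (take i0 t0) = s1.
  rewrite map_take; have := congr1 (take i0) et.
  by rewrite take_size_cat // /emb -cats1 takel_cat // size_map size_tuple ltnW.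
have e2 : rcons (map val (drop i0.+1 t0)) 0%VS = Z :: s2.
  have := congr1 (drop i0.+1) et; rewrite -cat_rcons drop_size_cat ?size_rcons // => ->.
  by rewrite map_drop /emb drop_rcons // size_map size_tuple.
by rewrite e1 e2 (negbTE nzs).
Qed.

Definition unext (c : seq {vspace V} -> int) : {ffun k.-tuple T -> int} :=
  [ffun t : k.-tuple T => c (emb t)].

Lemma unextK c : (forall s, c s != 0 -> flag hforms {: V}%VS s) ->
  (forall s, ext (unext c) s = c s) /\ unext c \in @chain_group T (@latt_lt R d A) (Lbar A) k.
Proof.
move=> fl; split.
  move=> s; have [cs|nz] := eqVneq (c s) 0.
    by rewrite cs /ext big1 // => t /eqP e; rewrite ffunE e.
  have := fl s nz; rewrite flag_step => /andP[p /eqP l0].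
  by have [t [-> _ _]] := step_emb p l0; rewrite extE ffunE.
apply/forallP => t; apply/implyP; rewrite ffunE => /fl; rewrite flag_step => /andP[p /eqP l0].
have [t' [e srt inL]] := step_emb p l0.
by rewrite (emb_inj e) srt.
Qed.

Lemma cyc_cycle c : cyc hforms {: V}%VS c -> unext c \in @cycles T (@latt_lt R d A) (Lbar A) k.
Proof.
move=> cc; have [fl _ _] := cc; have [e ch] := unextK fl.
rewrite inE ch /=; apply/eqP/ffunP => u; rewrite [RHS]ffunE.
have [[t0 [i0 [nz e0]]]|no] := pselect (exists (t0 : k.-tuple T) (i0 : 'I_k),
    unext c t0 != 0 /\ omit i0 t0 = u :> seq T).
  rewrite (boundary_ext ch (ltn_ord i0) nz e0).
  have [Z [s2 e2]] : exists Z s2, rcons (map val (drop i0 u)) 0%VS = Z :: s2.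
    by case: (map _ _) => [|Z s2]; [exists 0%VS, [::] | exists Z, (rcons s2 0%VS)].
  rewrite e2; under eq_bigr do rewrite e.
  have F1 := intersections_ker; have F2 := intersections_hyps.
  move: cc; rewrite -{1}restr_full => cc'.
  by rewrite (cyc_balanced (fset_uniq T) F1 F2 full_intersections cc') mulr0.
rewrite ffunE big1 // => t _; rewrite big1 // => i /eqP ei.
have [-> |nz] := eqVneq (unext c t) 0; first by rewrite mulr0.
by case: no; exists t, i.
Qed.

(** Such a chain would have [d] strictly decreasing dimensions between [d - 1] and [1]. *)
Lemma top_chain0 (P : {set T}) (b : {ffun k.+1.-tuple T -> int}) :
  P \subset Lbar A -> b \in @chain_group T (@latt_lt R d A) P k.+1 -> b = 0.
Proof.
move=> /fintype.subsetP sP /forallP bP; apply/ffunP => t; rewrite [RHS]ffunE; apply/eqP.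
apply: contraT => nz; have /implyP /(_ nz) /andP[srt /allP inP] := bP t.
suff : False by [].
case: t srt inP {nz bP} => -[|x t] //= szt srt inP.
have p : path (fun X Y => (Y <= X)%VS && (\dim Y < \dim X)%N) (val x) (map val t).
  elim: t x srt {szt inP} => [//|y t IH] x /= /andP[/andP[nxy yx] p].
  rewrite yx IH // andbT /= ltn_neqAle dimvS // andbT.
  by apply: contra nxy => /eqP e; rewrite eq_sym eqEdim yx e leqnn.
have := path_dim p; rewrite size_map last_map.
have /sP : last x t \in P by apply: inP; apply: mem_last.
rewrite in_Lbar => /andP[_]; rewrite -dimv_eq0 -lt0n => l0.
have /sP : x \in P by apply: inP; apply: mem_head.
rewrite in_Lbar => /andP[xf _].
have xd := dim_lt_full xf.
move: szt; rewrite eqSS => /eqP -> h.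
have := leq_trans (leq_add (leqnn k) l0) h; rewrite addn1 prednK // => h2.
by have := leq_trans xd h2; rewrite ltnn.
Qed.

Lemma hclass_inj (P : {set T}) (z z' : Defs.cycle (@latt_lt R d A) P k) : P \subset Lbar A ->
  hclass z = hclass z' -> z = z'.
Proof.
move=> sP /hclassP /asboolP[b /(top_chain0 sP) -> e].
apply/eqP; rewrite -subr_eq0; apply/eqP/val_inj.
by rewrite e boundary0.
Qed.

End Bridge.

(** * Chambers as connected components *)

Section Topology.
Variables (R : realType) (d : nat).
Local Notation V := 'rV[R]_d.
Local Notation form := 'Hom(V, R^o).
Implicit Types (l phi : form) (A : seq form) (x y v : V).

Lemma ev_continuous l : continuous (ev l : V -> R).
Proof.
have -> : (ev l : V -> R) = (fun x : V => \sum_(j < d) x 0 j * ev l (delta_mx 0 j)).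
  apply/funext => x; rewrite {1}(row_sum_delta x) /ev linear_sum; apply: eq_bigr => j _.
  exact: linearZ.
elim: (index_enum _) => [|j r IH].
  rewrite (_ : (fun _ => _) = (fun=> 0)); first exact: cst_continuous.
  by apply/funext => x; rewrite big_nil.
rewrite (_ : (fun _ => _) = (fun x : V => x 0 j * ev l (delta_mx 0 j) +
  \sum_(j <- r) x 0 j * ev l (delta_mx 0 j))); last first.
  by apply/funext => x; rewrite big_cons.
move=> x; apply: cvgD; [exact: nbhs_filter | | exact: IH].
exact: (@continuousM R V (fun x : V => x 0 j) (fun=> ev l (delta_mx 0 j)) x
  (@coord_continuous R 1 d 0 j x) (@cst_continuous _ _ _ x)).
Qed.

(** A connected set on which no form vanishes has constant signs, by the intermediate value
    property; conversely the segment from [x] to [y] stays in the chamber. *)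
Lemma component_same A x : gen A x ->
  connected_component [set y | gen A y] x = [set y | same A x y].
Proof.
move=> gx; apply/seteqP; split=> [y [B [Bx BA cB] By]|y sxy] /=.
  apply/allP => l lA.
  have /connected_intervalP iv : connected (ev l @` B).
    apply: connected_continuous_connected => //.
    exact/continuous_subspaceT/ev_continuous.
  have nz z : B z -> ev l z != 0 by move=> /BA /allP; apply.
  have Ix : (ev l @` B) (ev l x) by exists x.
  have Iy : (ev l @` B) (ev l y) by exists y.
  have no0 : ~ (ev l @` B) 0 by move=> [z /nz + e]; rewrite e eqxx.
  have := nz x Bx; have := nz y By.
  case: (ltrgt0P (ev l y)) => // hy _; case: (ltrgt0P (ev l x)) => // hx _.
  - exact: mulr_gt0.
  - by case: no0; apply: (iv _ _ Ix Iy); rewrite (ltW hx) (ltW hy).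
  - by case: no0; apply: (iv _ _ Iy Ix); rewrite (ltW hx) (ltW hy).
  - by rewrite nmulr_rgt0.
pose g t : V := x + t *: (y - x).
have cg : continuous g.
  move=> t; apply: cvgD; first exact: cvg_cst.
  by apply: cvgZr_tmp; exact: cvg_id.
apply: (@connected_component_max _ _ (g @` `[0, 1])).
- by exists 0; rewrite /= ?in_itv /= ?lexx ?ler01 // /g scale0r addr0.
- move=> _ [t /= t01 <-]; apply/allP => l lA /=.
  have := allP sxy l lA => pxy; move: t01; rewrite in_itv /= => /andP[t0 t1].
  rewrite /g evD evZ evB.
  have : 0 < ev l x * (ev l x + t * (ev l y - ev l x)).
    have x2 : 0 < ev l x * ev l x by rewrite -expr2 exprn_even_gt0 //= (allP gx).
    have -> : ev l x * (ev l x + t * (ev l y - ev l x)) =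
      (1 - t) * (ev l x * ev l x) + t * (ev l x * ev l y) by ring.
    have [->|tn] := eqVneq t 1; first by rewrite subrr mul0r add0r mul1r.
    apply: ltr_pwDl; last by rewrite mulr_ge0 // ltW.
    by rewrite mulr_gt0 // subr_gt0 lt_neqAle tn.
  by apply: contraTneq => ->; rewrite mulr0 ltxx.
- apply: connected_continuous_connected; first exact: segment_connected.
  exact: continuous_subspaceT.
- by exists 1; rewrite /= ?in_itv /= ?lexx ?ler01 // /g scale1r addrC subrK.
Qed.

Lemma closure_chamber_ge0 A x y : closure [set y | same A x y] y ->
  forall l, l \in A -> 0 <= ev l x * ev l y.
Proof.
move=> cl l lA; pose F := [set z : V | 0 <= ev (ev l x *: l) z].
have cF : closed F.
  rewrite (_ : F = ev (ev l x *: l) @^-1` [set r : R | 0 <= r]) //.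
  by apply: closed_comp => [z _|]; [exact: ev_continuous | exact: closed_ge].
have e z : ev (ev l x *: l) z = ev l x * ev l z by rewrite /ev scale_lfunE.
have sF : [set y | same A x y] `<=` F.
  by move=> z /allP /(_ l lA) h; rewrite /F /= e ltW.
by have := closure_subset sF cl; rewrite -(iffLR (closure_id F) cF) /F /= e.
Qed.

Lemma in_closure_chamber A x y : gen A x ->
  (forall l, l \in A -> ev l y != 0 -> 0 < ev l x * ev l y) ->
  closure [set y | same A x y] y.
Proof.
move=> gx h B /nbhs_ballP[e /= e0 eB].
pose t := e / (1 + `|x|) / 2.
have n1 : 0 < 1 + `|x| by rewrite ltr_pwDl.
have t0 : 0 < t by rewrite !divr_gt0.
exists (y + t *: x); split.
  apply/allP => l lA; rewrite evD evZ mulrDr mulrCA.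
  have x2 : 0 < ev l x * ev l x by rewrite -expr2 exprn_even_gt0 //= (allP gx).
  have [->|nz] := eqVneq (ev l y) 0; first by rewrite mulr0 add0r mulr_gt0.
  by apply: addr_gt0; [exact: h | exact: mulr_gt0].
apply: eB; rewrite -ball_normE /= opprD addNKr normrN normrZ gtr0_norm //.
rewrite /t mulrAC ltr_pdivrMr // mulrAC ltr_pdivrMr //.
rewrite -mulrA ltr_pM2l //; have := normr_ge0 x; lra.
Qed.

End Topology.

(** * Bounded chambers and fundamental cycles *)

(** Normalising a form with kernel [W] to be [1] at [p] requires [p] outside [W], which is
    genericity at the zero space. At a nonzero flat the expected dimension is not [-1], so [H] meets
    it, and [phi] is [1] at a common point. *)
Lemma generic_form (R : realType) (d : nat) (A : {fset {vspace 'rV[R]_d}}) (H : set 'rV[R]_d) :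
  essential A -> affine_hyperplane H -> generic A H ->
  exists phi : 'Hom('rV[R]_d, R^o), H = [set x | ev phi x = 1] /\
    forall Y, Y \in intersections A -> Y != 0%VS -> ~~ (Y <= lker phi)%VS.
Proof.
move=> eA [p [W [dW HE]]] gH.
have pW : p \notin W.
  have [[e _]|[p' [W' [_ /eqP]]]] := gH _ (zero_intersections eA); last by rewrite dimv0.
  apply/negP => pW; suff : set0 (0 : 'rV[R]_d) by [].
  by rewrite -e HE; split; rewrite /= ?mem0v // /translate /= sub0r memvN.
have [|l kl] := @hyperplane_form _ _ W; first by rewrite dW dim_rV.
have lp : ev l p != 0 by rewrite -mem_ker kl.
pose phi : 'Hom('rV[R]_d, R^o) := (ev l p)^-1 *: l.
have phiE x : ev phi x = (ev l p)^-1 * ev l x by rewrite /ev scale_lfunE.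
have HE' : H = [set x | ev phi x = 1].
  rewrite HE; apply/seteqP; split=> x /=; rewrite /translate /= -kl mem_ker evB subr_eq0 phiE.
    by move=> /eqP ->; rewrite mulVf.
  by move=> /(congr1 (fun r => ev l p * r)); rewrite mulrA mulfV // mul1r mulr1 => ->.
exists phi; split=> // Y YT Y0; apply/nvanishP.
have [[_ /eqP]|[p' [W' [e _]]]] := gH _ YT.
  by rewrite subr_eq addNr -[0]/(Posz 0) eqz_nat dimv_eq0 (negbTE Y0).
have : translate p' W' p' by rewrite /translate /= subrr mem0v.
rewrite -e HE' => -[/= p1 pY]; exists p' => //.
by rewrite p1 oner_neq0.
Qed.

Section Main.
Variables (R : realType) (d : nat) (A : {fset {vspace 'rV[R]_d}}).
Local Notation V := 'rV[R]_d.
Local Notation T := (intersections A).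
Local Notation Ah := (hforms A).
Local Notation k := d.-1.
Hypothesis hA : hyperplane_arrangement A.
Hypothesis eA : essential A.
Hypothesis d_gt0 : (0 < d)%N.
Variables (n : {vspace V} -> V) (phi : 'Hom(V, R^o)).
Hypothesis n_in : forall Y, Y \in T -> n Y \in Y.
Hypothesis n_gen : forall Y l, Y \in T -> l \in Ah -> ~~ (Y <= lker l)%VS -> ev l (n Y) != 0.
Hypothesis n_coh : forall Y K K', Y \in T -> K \in hyps (restr Ah Y) Y ->
  K' \in hyps (restr Ah Y) Y -> n K - n K' \in <[n Y]>%VS.
Hypothesis phi_gen : forall Y, Y \in T -> Y != 0%VS -> ~~ (Y <= lker phi)%VS.
Local Notation H := [set x : V | ev phi x = 1].
Implicit Types (x y v : V) (C : set V).

Let Fl : pred {vspace V} := fun Y => Y \in T.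
Let Fl_cap : forall Y l, Fl Y -> l \in Ah -> Fl (Y :&: lker l)%VS.
Proof. exact: intersections_ker. Qed.

Lemma framed_full : framed Fl Ah Ah {: V}%VS.
Proof. by split=> //; [exact: full_intersections | exact: hforms_nonv]. Qed.

Lemma framed_flat Y : Y \in T -> framed Fl Ah (restr Ah Y) Y.
Proof. by move=> YT; split=> //; [exact: restr_sub | exact: nonv_restr]. Qed.

Lemma hforms_neq0 x : same Ah x 0 -> False.
Proof.
move=> /allP s0; have : (\dim {: V} == 0)%N; last by rewrite dim_rV eqn0Ngt d_gt0.
rewrite dimv_eq0 -eA; apply/eqP; apply/esym; rewrite big_seq big_pred0 // => K.
apply/negP => KA; have := s0 _ (hform_in KA); by rewrite ev0 mulr0 ltxx.
Qed.

Lemma positive_gt0 x : positive phi Ah {: V}%VS x -> forall y, same Ah x y -> 0 < ev phi y.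
Proof.
move=> px y sy; apply: px => //; first exact: memvf.
by apply: contraPneq sy => -> /hforms_neq0.
Qed.

Lemma positive_same x y : same Ah x y -> positive phi Ah {: V}%VS x ->
  positive phi Ah {: V}%VS y.
Proof. by move=> sxy px z zV nz syz; apply: px => //; apply: same_trans syz. Qed.

(** In the smallest flat [Y] through [y], a value [phi <= 0] can be perturbed to a point [w],
    generic in [Y], with [phi < 0]; pushing [w] in the direction [x] enters the open chamber while
    [phi] stays negative. *)
Lemma positive_closure x y : gen Ah x -> positive phi Ah {: V}%VS x -> y != 0 ->
  (forall l, l \in Ah -> 0 <= ev l x * ev l y) -> 0 < ev phi y.
Proof.
move=> gx px ny wy; rewrite ltNge; apply/negP => py.
pose B := [fset K in A | y \in K]%fset.
pose Y := (\bigcap_(K <- B) K)%VS.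
have YT : Y \in T by apply/intersectionsP; exists B => //; apply: fset_sub.
have yY : y \in Y by apply/mem_bigcapv => K; rewrite !inE => /andP[].
have Yl l : l \in Ah -> ev l y = 0 -> (Y <= lker l)%VS.
  move=> /hformsP[K KA ->] /eqP; rewrite -mem_ker (ker_hform hA KA) => yK.
  apply/subvP => z /mem_bigcapv; apply; by rewrite !inE KA.
have Y0 : Y != 0%VS by apply: contraNneq ny => Y0; rewrite Y0 memv0 in yY.
have [w wY [pw gw sw]] := neg_perturb n_in n_gen phi_gen (framed_flat YT) Y0 yY py.
pose z := push (phi :: Ah) w x.
have bz : beside (phi :: Ah) w x z.
  apply: push_beside => l; rewrite inE => /orP[/eqP -> p0|lA _]; last exact: (allP gx).
  by rewrite p0 ltxx in pw.
have pz : ev phi z < 0.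
  by have := allP bz phi (mem_head _ _); rewrite lt_eqF // nmulr_rgt0.
have sxz : same Ah x z.
  apply/allP => l lA; have := allP bz l; rewrite inE lA orbT => /(_ isT).
  case: eqP => // nw h; have nl : ~~ (Y <= lker l)%VS.
    by apply: contra_notN nw => Yl'; apply: vanish_ev wY.
  have lr : l \in restr Ah Y by rewrite mem_filter nl.
  have ly : ev l y != 0 by apply: contra nl => /eqP; apply: Yl.
  have h1 := sw l lr ly.
  have h2 : 0 < ev l y * ev l x by rewrite mulrC lt_neqAle eq_sym mulf_neq0 ?wy // (allP gx).
  have h3 : 0 < ev l w * ev l x by apply: mul_pos_trans h2.
  exact: mul_pos_trans h3 h.
by have := positive_gt0 px sxz; rewrite lt_gtF.
Qed.

(** By compactness [phi] has a positive minimum on the unit vectors of the closed cone; its inverse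
    bounds the norm of points with [phi = 1]. *)
Lemma positive_bounded x : gen Ah x -> positive phi Ah {: V}%VS x ->
  bounded_set ([set y | same Ah x y] `&` H).
Proof.
move=> gx px.
pose S := [set y : V | (forall l, l \in Ah -> 0 <= ev l x * ev l y) /\ `|y| = 1].
have nS y : y != 0 -> same Ah x y -> S (`|y|^-1 *: y).
  move=> ny sy; have y0 : 0 < `|y| by rewrite normr_gt0.
  split; last by rewrite normrZ gtr0_norm ?invr_gt0 // mulVf // gt_eqF.
  move=> l lA; rewrite evZ mulrCA mulr_ge0 ?invr_ge0 //.
  by apply: ltW; apply: (allP sy).
have n0 y : same Ah x y -> y != 0 by move=> sy; apply: contraPneq sy => -> /hforms_neq0.
have [S0|S0] := pselect (S !=set0); last first.
  exists 0; split; first exact: num_real.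
  move=> M _ y [/= sy _]; case: S0; exists (`|y|^-1 *: y); apply: nS => //; exact: n0.
have cS : compact S.
  apply: bounded_closed_compact.
    exists 1; split; first exact: num_real.
    by move=> M M1 y [_ /= ny]; rewrite /= ny; apply: ltW.
  have -> : S = (\bigcap_(l in [set l | l \in Ah]) [set y : V | 0 <= ev (ev l x *: l) y]) `&`
      ((fun y : V => `|y|) @^-1` [set 1]).
    have e l y : ev (ev l x *: l) y = ev l x * ev l y by rewrite /ev scale_lfunE.
    apply/seteqP; split=> y /= [h1 h2]; split=> // l lA; first by rewrite /= e h1.
    by have := h1 l lA; rewrite /= e.
  apply: closedI.
    apply: closed_bigI => l _.
    rewrite (_ : [set y | _] = ev (ev l x *: l) @^-1` [set r : R | 0 <= r]) //.
    by apply: closed_comp => [z _|]; [exact: ev_continuous | exact: closed_ge].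
  apply: closed_comp => [z _|]; first exact: norm_continuous.
  exact: closed_eq.
have [c cS' cmin] := @EVT_min_rV R d (ev phi) S S0 cS
  (continuous_subspaceT (@ev_continuous R d phi)).
move: cS'; rewrite inE => -[c1 c2].
have pc : 0 < ev phi c.
  apply: (positive_closure gx px) => //.
  by rewrite -normr_eq0 c2 oner_neq0.
exists (ev phi c)^-1; split; first exact: num_real.
move=> M cM y [/= sy py]; apply: le_trans (ltW cM).
have ny := n0 y sy; have y0 : 0 < `|y| by rewrite normr_gt0.
have := cmin _ (mem_set (nS y ny sy)); rewrite evZ py mulr1 => h.
by rewrite /= -(invrK `|y|) lef_pV2 // posrE invr_gt0.
Qed.

(** From a point [y] of the chamber with [phi <= 0], the vector [v] is a positive combination of
    chamber points in the kernel of [phi]: the ray from [x0] along [v] stays in the chamber and in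
    [H]. *)
Lemma bounded_positive x : gen Ah x -> ([set y | same Ah x y] `&` H) !=set0 ->
  bounded_set ([set y | same Ah x y] `&` H) -> positive phi Ah {: V}%VS x.
Proof.
move=> gx [x0 [/= sx0 px0]] [M [_ MP]] y _ ny sy; rewrite ltNge; apply/negP => py.
pose v := y - ev phi y *: x0.
have sxv : same Ah x v.
  apply/allP => l lA; rewrite evB evZ -mulNr mulrDr mulrCA; apply: ltr_pwDl.
    exact: (allP sy).
  by rewrite mulr_ge0 ?oppr_ge0 // ltW // (allP sx0).
have pv : ev phi v = 0 by rewrite evB evZ px0 mulr1 subrr.
have nv : v != 0 by apply: contraPneq sxv => -> /hforms_neq0.
have v0 : 0 < `|v| by rewrite normr_gt0.
pose M1 := `|M| + 1.
pose t := (M1 + `|x0| + 1) / `|v|.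
have t0 : 0 < t.
  by rewrite divr_gt0 // ltr_wpDl // !addr_ge0.
have MM1 : M < M1 by rewrite (le_lt_trans (ler_norm _)) // ltrDl.
have h : `|t *: v| <= `|x0 + t *: v| + `|x0|.
  by have := ler_normB (x0 + t *: v) x0; rewrite addrAC subrr add0r.
have : `|x0 + t *: v| <= M1.
  apply: (MP M1 MM1); split=> /=; last by rewrite evD evZ pv mulr0 addr0.
  apply/allP => l lA; rewrite evD evZ mulrDr mulrCA; apply: ltr_wpDr.
    by rewrite mulr_ge0 ?(ltW t0) // ltW // (allP sxv).
  exact: (allP sx0).
move=> h2; have : `|t *: v| <= M1 + `|x0| by rewrite (le_trans h) // lerD2r.
rewrite normrZ gtr0_norm // /t divfK ?gt_eqF //.
by rewrite gerDl ler10.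
Qed.

Lemma complement_gen : arrangement_complement A = [set x | gen Ah x].
Proof.
apply/seteqP; split=> x /= h.
  apply/allP => l /hformsP[K KA ->]; rewrite -mem_ker (ker_hform hA KA); exact: h.
by move=> K KA; rewrite -(ker_hform hA KA) mem_ker; apply: (allP h); apply: hform_in.
Qed.

Definition chamber x := [set y | same Ah x y].

Lemma region_chamber C : region A C <-> exists2 x, gen Ah x & C = chamber x.
Proof.
rewrite /region complement_gen; split=> -[x gx ->]; exists x => //.
  exact: component_same.
by rewrite component_same.
Qed.

Lemma chamber_same x y : same Ah x y -> chamber x = chamber y.
Proof.
move=> sxy; apply/seteqP; split=> z /=; apply: same_trans => //.
by rewrite same_sym.
Qed.

(** The functional [f] is minus the sum of the forms vanishing on [Y], each weighted by its value at
    [x]: on the closure it is at most [0], with equality exactly on [Y]. Small pushes of [y] in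
    every direction of [Y] stay in this face, so it spans [Y]. *)
Lemma face_span x y Y : Y \in T -> gen Ah x -> y \in Y -> gen (restr Ah Y) y ->
  (forall l, l \in Ah -> ev l y != 0 -> 0 < ev l x * ev l y) ->
  exists F, [/\ face (closure (chamber x)) F, F !=set0 & linear_span F Y].
Proof.
move=> YT gx yY gy sy.
pose f : 'Hom(V, R^o) := - \sum_(l <- Ah | (Y <= lker l)%VS) ev l x *: l.
have fE z : f z = - \sum_(l <- Ah | (Y <= lker l)%VS) ev l x * ev l z :> R.
  rewrite /f opp_lfunE sum_lfunE; congr (- _).
  by apply: eq_bigr => l _; rewrite scale_lfunE.
have cl_ge0 z : closure (chamber x) z -> forall l, l \in Ah -> 0 <= ev l x * ev l z.
  by move=> clz l; apply: closure_chamber_ge0 clz l.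
have f_le0 z : closure (chamber x) z -> f z <= 0 :> R.
  move=> /cl_ge0 h; rewrite fE oppr_le0 big_seq_cond sumr_ge0 // => l /andP[lA _].
  exact: h.
have f_eq0 z : z \in Y -> f z = 0 :> R.
  by move=> zY; rewrite fE big1 ?oppr0 // => l Yl; rewrite (vanish_ev Yl zY) mulr0.
exists [set z | closure (chamber x) z /\ f z = 0 :> R].
have FY z : z \in Y -> (forall l, l \in Ah -> ev l z != 0 -> 0 < ev l x * ev l z) ->
    [set z | closure (chamber x) z /\ f z = 0 :> R] z.
  by move=> zY sz; split; [apply: in_closure_chamber | apply: f_eq0].
split.
- by exists f, 0; split=> //; apply: f_le0.
- by exists y; apply: FY.
split=> [z [clz fz]|W FW].
  apply: (intersections_flat hA YT) => l lA Yl.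
  have h := cl_ge0 z clz; move: fz; rewrite fE => /eqP; rewrite oppr_eq0.
  rewrite big_seq_cond psumr_eq0 => [/allP /(_ l lA)|l' /andP[l'A _]]; last exact: h.
  by rewrite lA Yl /= mulf_eq0 (negbTE (allP gx l lA)) => /eqP.
apply/subvP => v vY.
have yW : y \in W by apply: FW; apply: FY.
have : push Ah y v \in W.
  apply: FW; apply: FY; first exact: push_in.
  move=> l lA nz; have ny : ev l y != 0.
    have nl : ~~ (Y <= lker l)%VS.
      by apply: contra nz => Yl; rewrite (vanish_ev Yl (push_in _ yY vY)).
    by apply: (allP gy); rewrite mem_filter nl.
  have h := eps_sign v lA ny.
  by apply: mul_pos_trans h; rewrite mulrC sy.
rewrite /push => pW.
have : eps Ah y v *: v \in W by rewrite -[_ *: v](addKr y) memvD // memvN.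
by rewrite rpredZeq gt_eqF ?eps_gt0.
Qed.

(** * Indicators of chambers and the basis *)

Definition ind x y : int := if same Ah x y then 1 else 0.

Lemma chamberfun_ind x : positive phi Ah {: V}%VS x -> chamberfun phi Ah {: V}%VS (ind x).
Proof.
move=> px; split=> [y y' _ _ syy|y _ _].
  rewrite /ind (_ : same Ah x y = same Ah x y') //.
  apply/idP/idP => h; first exact: same_trans syy.
  by apply: same_trans h _; rewrite same_sym.
by rewrite /ind; case: ifP => [sxy _|]; rewrite ?eqxx //; apply: positive_same px.
Qed.

Lemma ind_cycle x : gen Ah x -> positive phi Ah {: V}%VS x ->
  unext A (flag_jump n Ah {: V}%VS (ind x)) \in
    cycles (@latt_lt R d A) (proper_part (zP A (chamber x))) (k := k).
Proof.
move=> gx px; have ca := chamberfun_ind px.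
have := cyc_cycle hA eA d_gt0 (cyc_flag_jump Fl_cap n_in n_gen n_coh framed_full (proj1 ca)).
move=> /andP[/forallP ch b0]; apply/andP; split=> //; apply/forallP => t; apply/implyP => nz.
have /implyP /(_ nz) /andP[-> /allP inL] := ch t; apply/allP => y0 y0t.
rewrite !inE -in_Lbar inL // andbT; apply/asboolP.
have Ys : val y0 \in emb t by rewrite mem_rcons inE map_f ?orbT.
move: nz; rewrite ffunE => nz.
have [y [x' [[yY gy _ _]]]] := flag_jump_supp Fl_cap n_in n_gen framed_full nz Ys.
rewrite /ind; case: ifP => [sxx' _ sy|]; rewrite ?eqxx //.
apply: (@face_span x y) => //; first exact: fsvalP.
move=> l lA ny; have h := sy l lA ny.
have := allP sxx' l lA; rewrite mulrC => h2; apply: (@mul_pos_trans _ (ev l x')) => //.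
by rewrite mulrC.
Qed.

Lemma hclass_sum (P : {set T}) (I : Type) (r : seq I)
    (z : I -> Defs.cycle (@latt_lt R d A) P k) (a : I -> int) :
  hclass (\sum_(i <- r) z i *~ a i) = \sum_(i <- r) hclass (z i) *~ a i.
Proof. by rewrite /hclass raddf_sum; apply: eq_bigr => i _; rewrite raddfMz. Qed.

Lemma ffun_mulz (I : finType) (c : {ffun I -> int}) (m : int) i : (c *~ m) i = c i * m.
Proof.
have nat_case p : (c *+ p) i = c i * p%:Z.
  by elim: p => [|p IH]; rewrite ?mulr0n ?ffunE ?mulr0 // mulrS ffunE IH intS mulrDr mulr1.
case: m => p; first exact: nat_case.
by rewrite NegzE mulrNz ffunE -pmulrn nat_case mulrN.
Qed.

Lemma ext_sum (I : Type) (r : seq I) (c : I -> {ffun k.-tuple T -> int}) (a : I -> int) s :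
  ext (\sum_(i <- r) c i *~ a i) s = \sum_(i <- r) ext (c i) s * a i.
Proof.
rewrite /ext; under [RHS]eq_bigr do rewrite big_distrl /=.
rewrite exchange_big /=; apply: eq_bigr => t _; rewrite sum_ffunE.
by apply: eq_bigr => i _; rewrite ffun_mulz.
Qed.

Lemma proper_part_sub (P : {set T}) : proper_part P \subset Lbar A.
Proof. by apply/fintype.subsetP => x; rewrite !inE => /andP[_]. Qed.

(* The indicator of the chamber is [m] times the fundamental cycle, which in turn comes from
   an integral chamber function: this forces [m] to be invertible. *)
Lemma fundamental_ind x (r : homology (@latt_lt R d A) (Lbar A) k) :
  gen Ah x -> positive phi Ah {: V}%VS x -> fundamental_class (chamber x) r ->
  exists (w : Defs.cycle (@latt_lt R d A) (Lbar A) k) (e m : int),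
    [/\ r = hclass w, e * m = 1 & forall s, ext (val w) s = flag_jump n Ah {: V}%VS (ind x) s * e].
Proof.
move=> gx px [z [w [gen_z wz rw]]].
pose z' := Cycle (ind_cycle gx px).
have [m [hm _]] := gen_z (hclass z').
have zm : z' = z *~ m.
  apply: (hclass_inj d_gt0 (proper_part_sub _)); rewrite hm.
  by rewrite /hclass raddfMz.
have ca := chamberfun_ind px.
have cD := cyc_flag_jump Fl_cap n_in n_gen n_coh framed_full (proj1 ca).
have wm s : flag_jump n Ah {: V}%VS (ind x) s = ext (val w) s * m.
  have [fl _ _] := cD; have [<- _] := unextK hA d_gt0 fl.
  have -> : unext A (flag_jump n Ah {: V}%VS (ind x)) = val w *~ m.
    by rewrite wz -(raddfMz val) -zm.
  by have := @ext_sum unit [:: tt] (fun=> val w) (fun=> m) s; rewrite !big_seq1.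
have [b cb Db] := flag_jump_surj Fl_cap n_in n_gen n_coh phi_gen framed_full
  (cycle_cyc hA eA d_gt0 (valP w)).
(* [ind x] and [m] times [b] are both supported on positive chambers and have the same iterated
   jumps, hence agree at [x]. *)
have bm : b x * m = 1.
  have cd : chamberfun phi Ah {: V}%VS (fun y => ind x y - b y * m).
    split=> [y y' yV y'V syy|y yV gy].
      by rewrite (proj1 ca y y') // (proj1 cb y y').
    have [->|nb _] := eqVneq (b y) 0; last exact: (proj2 cb).
    by rewrite mul0r subr0; apply: (proj2 ca).
  have := flag_jump_inj Fl_cap n_in n_gen phi_gen framed_full cd _ (memvf x) gx.
  rewrite /ind same_refl // => h; apply/esym/eqP; rewrite -subr_eq0; apply/eqP/h => s.
  have -> : (fun y => ind x y - b y * m) = (fun y => ind x y + b y * - m).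
    by apply/funext => y; rewrite mulrN.
  by rewrite flag_jumpD flag_jumpZ Db mulrN wm subrr.
exists w, (b x), m; split=> // s.
by rewrite wm -mulrA (mulrC m) bm mulr1.
Qed.

Definition bounded_regions :=
  [set C | [/\ region A C, (C `&` H) !=set0 & bounded_set (C `&` H)]].

Lemma bounded_regionP C : bounded_regions C <->
  exists x, [/\ gen Ah x, positive phi Ah {: V}%VS x & C = chamber x].
Proof.
split=> [[/region_chamber[x gx ->] ne bd]|[x [gx px ->]]].
  by exists x; split=> //; apply: bounded_positive.
split; first by apply/region_chamber; exists x.
  have p0 := positive_gt0 px (same_refl gx).
  exists ((ev phi x)^-1 *: x); split; last by rewrite /= evZ mulVf // gt_eqF.
  apply/allP => l lA; rewrite evZ mulrCA mulr_gt0 ?invr_gt0 //.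
  by rewrite -expr2 exprn_even_gt0 //= (allP gx).
exact: positive_bounded.
Qed.

(** A chamber is the set of generic points with a given vector of truth values of [0 < ev l y], and
    there are finitely many such vectors. *)
Lemma finite_bounded_regions : exists2 Cs : seq (set V), uniq Cs &
  forall C, C \in Cs <-> bounded_regions C.
Proof.
pose sgn y : (size Ah).-tuple bool := map_tuple (fun l => 0 < ev l y) (in_tuple Ah).
pose cell s := [set y | gen Ah y /\ sgn y = s].
pose Cs := undup [seq C <- [seq cell s | s : (size Ah).-tuple bool] | `[< bounded_regions C >]].
exists Cs; first exact: undup_uniq.
move=> C; rewrite mem_undup mem_filter; split=> [/andP[/asboolP]//|bC].
rewrite asboolT //=; have [x [gx _ ->]] := iffLR (bounded_regionP C) bC.
apply/mapP; exists (sgn x); first by rewrite mem_enum.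
apply/seteqP; split=> y /=.
  move=> sxy; split; first exact: same_genr sxy.
  apply: val_inj => /=; apply/eq_in_map => l lA; apply/idP/idP => h.
    by have := allP sxy l lA; rewrite pmulr_lgt0.
  by have := allP sxy l lA; rewrite pmulr_rgt0.
move=> [gy /(congr1 val) /= /eq_in_map e]; apply/allP => l lA.
have := e l lA; have := allP gx l lA; have := allP gy l lA.
case: (ltrgt0P (ev l y)) => // hy _; case: (ltrgt0P (ev l x)) => // hx _ _.
  exact: mulr_gt0.
by rewrite nmulr_rgt0.
Qed.

Lemma sum_finsupp (M : zmodType) (I : choiceType) (a : {fsfun I -> int with 0}) (b : I -> M)
    (r : seq I) : uniq r -> {subset finsupp a <= r} ->
  \sum_(i <- finsupp a) b i *~ a i = \sum_(i <- r) b i *~ a i.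
Proof.
move=> ur sr; rewrite [RHS](bigID (mem (finsupp a))) /= [X in _ = _ + X]big1 => [|i]; last first.
  by rewrite memNfinsupp => /eqP ->; rewrite mulr0z.
rewrite addr0 -[RHS]big_filter; apply: perm_big; apply: uniq_perm.
- exact: fset_uniq.
- exact: filter_uniq.
- by move=> i; rewrite mem_filter; apply/esym/andb_idr; apply: sr.
Qed.

Lemma bounded_regions_basis (rho : set V -> homology (@latt_lt R d A) (Lbar A) k) :
  (forall C, region A C -> fundamental_class C (rho C)) -> Zbasis bounded_regions rho.
Proof.
move=> fund h.
have [Cs uCs CsP] := finite_bounded_regions.
pose rp C : V := xget 0 C.
have rpP C : C \in Cs ->
    [/\ gen Ah (rp C), positive phi Ah {: V}%VS (rp C) & C = chamber (rp C)].
  move=> /CsP/bounded_regionP[x [gx px eC]].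
  have : C (rp C) by apply: (@xgetPex _ 0 C); exists x; rewrite eC; apply: same_refl.
  rewrite {1}eC => sx; split; first exact: same_genr sx.
    exact: positive_same px.
  by rewrite eC; apply: chamber_same; rewrite -eC.
(* A dummy triple outside [Cs] lets [choice] produce a total function. *)
have ex_fund C : exists p : Defs.cycle (@latt_lt R d A) (Lbar A) k * int * int,
    C \in Cs -> [/\ rho C = hclass p.1.1, p.1.2 * p.2 = 1 &
      forall s, ext (val p.1.1) s = flag_jump n Ah {: V}%VS (ind (rp C)) s * p.1.2].
  have [CC|nC] := boolP (C \in Cs); last by exists (0, 0, 0).
  have [gx px eC] := rpP C CC.
  have [|w [e [m [h1 h2 h3]]]] := @fundamental_ind (rp C) (rho C) gx px.
    by rewrite -eC; apply: fund; have [] := iffLR (CsP C) CC.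
  by exists (w, e, m).
have [f fP] := choice ex_fund.
pose w C := (f C).1.1; pose e C := (f C).1.2; pose m C := (f C).2.
(* The chamber function whose iterated jump is the combination of the cycles [w C] with coefficients
   [al C]. *)
pose G (al : set V -> int) x := \sum_(C <- Cs) ind (rp C) x * (e C * al C).
have ind_uniq x C C' : C \in Cs -> C' \in Cs -> same Ah (rp C) x -> same Ah (rp C') x -> C = C'.
  move=> CC CC' s1 s2; have [_ _ ->] := rpP C CC; have [_ _ ->] := rpP C' CC'.
  by rewrite (chamber_same s1) (chamber_same s2).
have G_in al x C : C \in Cs -> same Ah (rp C) x -> G al x = e C * al C.
  move=> CC sx; rewrite /G (bigD1_seq C) //= {1}/ind sx mul1r big_seq_cond big1 ?addr0 //.
  move=> C' /andP[CC' nC]; rewrite /ind; case: ifP => [sx'|]; last by rewrite mul0r.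
  by rewrite (ind_uniq x C' C) ?eqxx in nC.
have G_out al x : (forall C, C \in Cs -> ~~ same Ah (rp C) x) -> G al x = 0.
  move=> no; rewrite /G big_seq big1 // => C /no; rewrite /ind => /negbTE ->.
  by rewrite mul0r.
have G_chamberfun al : chamberfun phi Ah {: V}%VS (G al).
  split=> [x y xV yV sxy|x xV gx nz].
    rewrite /G big_seq [RHS]big_seq; apply: eq_bigr => C CC; congr (_ * _).
    have [_ px _] := rpP C CC; exact: (proj1 (chamberfun_ind px)).
  have [C CC sx] : exists2 C, C \in Cs & same Ah (rp C) x.
    apply: contrapT => no; case/negP: nz; rewrite G_out // => C CC; apply/negP => sx.
    by apply: no; exists C.
  by have [_ px _] := rpP C CC; apply: positive_same px.
have wG al s : ext (val (\sum_(C <- Cs) w C *~ al C)) s = flag_jump n Ah {: V}%VS (G al) s.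
  have -> : val (\sum_(C <- Cs) w C *~ al C) = \sum_(C <- Cs) val (w C) *~ al C.
    by rewrite raddf_sum; apply: eq_bigr => C _; rewrite raddfMz.
  rewrite ext_sum /G flag_jump_sum big_seq [RHS]big_seq; apply: eq_bigr => C CC.
  by rewrite flag_jumpZ; have [_ _ ->] := fP C CC; rewrite mulrA.
have rhoG al : hclass (\sum_(C <- Cs) w C *~ al C) = \sum_(C <- Cs) rho C *~ al C.
  rewrite hclass_sum big_seq [RHS]big_seq; apply: eq_bigr => C CC.
  by have [-> _ _] := fP C CC.
have [c hc] : exists c, h = hclass c by exists (repr h); rewrite /hclass reprK.
have [a [ia pa] Da] := flag_jump_surj Fl_cap n_in n_gen n_coh phi_gen framed_full
  (cycle_cyc hA eA d_gt0 (valP c)).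
(* The factor [m C] cancels the unit [e C], so that [G al] and [a] agree at generic points. *)
pose al : {fsfun set V -> int with 0} :=
  [fsfun C in [fset C in Cs]%fset => a (rp C) * m C | 0].
have alE C : C \in Cs -> al C = a (rp C) * m C.
  by move=> CC; rewrite fsfunE inE /= CC.
have al_sub : {subset finsupp al <= Cs}.
  by move=> C; rewrite mem_finsupp fsfunE inE /=; case: ifP; rewrite ?eqxx.
have h_al : h = \sum_(C <- Cs) rho C *~ al C.
  rewrite -rhoG hc; congr hclass.
  apply: val_inj; apply/ffunP => t; rewrite -!extE wG -Da.
  apply: (flag_jump_ext Fl_cap n_in n_gen _ framed_full) => x xV gx.
  have [[C CC sx]|no] := pselect (exists2 C, C \in Cs & same Ah (rp C) x).
    have [_ em _] := fP C CC.
    rewrite (G_in _ _ C) // alE // mulrCA [e C * m C]em mulr1.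
    by apply: ia => //; [exact: memvf | rewrite same_sym].
  rewrite G_out => [|C CC]; last by apply/negP => sx; apply: no; exists C.
  apply/eqP; apply: contraT => nz; case: no.
  have CC : chamber x \in Cs.
    by apply/CsP/bounded_regionP; exists x; split=> //; apply: pa.
  exists (chamber x) => //; have [_ _ eC] := rpP _ CC.
  have : chamber x x by apply: same_refl.
  by rewrite {1}eC.
exists al; split.
  by split; [move=> C /al_sub /CsP | rewrite (sum_finsupp _ uCs al_sub)].
move=> al' [sub' h'].
have al'_sub : {subset finsupp al' <= Cs} by move=> C /sub' /CsP.
(* Equal classes in top degree are equal cycles, so [G be] has zero iterated jump and vanishes at
   [rp C]; multiplying by [m C] removes the unit [e C]. *)
pose be C := al C - al' C.
have be0 : \sum_(C <- Cs) w C *~ be C = 0.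
  have -> : \sum_(C <- Cs) w C *~ be C =
      \sum_(C <- Cs) w C *~ al C - \sum_(C <- Cs) w C *~ al' C.
    by rewrite -sumrB; apply: eq_bigr => C _; rewrite mulrzBr.
  apply/eqP; rewrite subr_eq0; apply/eqP.
  apply: (hclass_inj d_gt0 (fintype.subxx _)).
  by rewrite !rhoG -(sum_finsupp _ uCs al'_sub) -h' -h_al.
apply/fsfunP => C; have [CC|nC] := boolP (C \in Cs); last first.
  have out (g : {fsfun set V -> int with 0}) : {subset finsupp g <= Cs} -> g C = 0.
    by move=> sg; apply/eqP; rewrite -memNfinsupp; apply: contra nC; apply: sg.
  by rewrite !out.
have DG s : flag_jump n Ah {: V}%VS (G be) s = 0.
  by rewrite -wG be0 /ext big1 // => t _; rewrite ffunE.
have [gx _ _] := rpP C CC.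
have := flag_jump_inj Fl_cap n_in n_gen phi_gen framed_full (G_chamberfun be) DG (memvf _) gx.
rewrite (G_in _ _ C) ?same_refl // => /(congr1 (fun r => m C * r)).
have [_ em _] := fP C CC.
rewrite mulr0 mulrA [m C * _]mulrC [e C * m C]em mul1r => /eqP.
by rewrite subr_eq0 => /eqP.
Qed.

End Main.

Theorem theorem4p2 (R : realType) (d : nat) (A : {fset {vspace 'rV[R]_d}})
    (H : set 'rV[R]_d)
    (rho : set 'rV[R]_d -> homology (@latt_lt R d A) (Lbar A) d.-1) :
  hyperplane_arrangement A -> essential A ->
  affine_hyperplane H -> generic A H ->
  (forall C, region A C -> fundamental_class C (rho C)) ->
  Zbasis [set C | [/\ region A C, (C `&` H) !=set0 & bounded_set (C `&` H)]] rho.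
Proof.
move=> hA eA hH gH fund.
have d_gt0 : (0 < d)%N.
  by case: hH => p [W [e _]]; apply: leq_trans (ltn0Sn (\dim W)) _; rewrite e.
have [phi [HE phi_gen]] := generic_form eA hH gH.
have [n [n_in n_gen n_coh]] :=
  @framing_exists R 'rV[R]_d (enum_fset (intersections A)) (hforms A) (intersections_ker hA).
rewrite HE; exact: (bounded_regions_basis hA eA d_gt0 n_in n_gen n_coh phi_gen).
Qed.
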